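(* Let $V$ be a VOA of central charge $c$ with an involutive automorphism $t$, $V=V^+\oplus V^-$ its decomposition into $\pm1$-eigenspaces, $u,v\in V^-$ and $n\ge1$. Then \[ Z_{V^+}(u[-n]v,\tau)=\tfrac12\delta_{n,1}\mathrm{Tr}_V\,o(u)o(v)q^{L(0)-c/24}+\sum_{m\ge0}\frac1m\widehat F_{n+m}(\tau)Z_{V^+}(u[m]v,\tau)+\frac12\sum_{m\ge1}\frac1m\big(\widehat E_{n+m}(\tau)-\widehat F_{n+m}(\tau)\big)Z_V(u[m]v,\tau), \] where $\frac1m\widehat F_{n+m}(\tau)$ means $(-1)^{m+1}\binom{n+m-1}{m}F_{n+m}(\tau)$ (so the $m=0$ term equals $-F_n(\tau)Z_{V^+}(u[0]v,\tau)$).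
   Context: $q=e^{2\pi i\tau}$. Square bracket modes: $Y[v,z]=\sum_nv[n]z^{-n-1}:=Y_V(e^{zL(0)}v,e^z-1)$. Zero mode $o(v)=v(w-1)$ for $v$ of weight $w$, extended linearly. $Z_W(x,\tau)=\mathrm{Tr}_Wo(x)q^{L(0)-c/24}$ for $W=V,V^+$. $E_k(\tau)=-\frac{B_k}{k!}+\frac{2}{(k-1)!}\sum_{n\ge1}\sigma_{k-1}(n)q^n$ for even $k$, $E_k=0$ for odd $k$; $F_k(\tau)=2E_k(2\tau)-E_k(\tau)$. For positive integers $a,b$: $\widehat E_{a+b}=(-1)^{b+1}b\binom{a+b-1}{b}E_{a+b}$, $\widehat F_{a+b}=(-1)^{b+1}b\binom{a+b-1}{b}F_{a+b}$ (here $a=n$, $b=m$). *)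

(* Defs.v *)
From HB Require Import structures.
From mathcomp Require Import all_boot all_order all_algebra.
From Stdlib Require Import ClassicalEpsilon.
From mathcomp Require Import complex.
From mathcomp Require Import reals.
Set Implicit Arguments. Unset Strict Implicit. Unset Printing Implicit Defensive.
Import Order.TTheory GRing.Theory Num.Theory.
Local Open Scope ring_scope.

Definition nbound (P : nat -> Prop) : nat := epsilon (inhabits 0%N) P.

Definition nsum (X : zmodType) (a : nat -> X) : X :=
  \sum_(i < nbound (fun M => forall i, (M <= i)%N -> a i = 0)) a i.

Definition zsum (X : zmodType) (a : int -> X) : X :=
  let B := nbound (fun B => forall k : int, (B < absz k)%N -> a k = 0) in
  \sum_(i < B.*2.+1) a (i%:Z - B%:Z).

Definition binz (K : fieldType) (r : int) (i : nat) : K :=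
  (\prod_(j < i) (r%:~R - j%:R)) / (i`!)%:R.

Section VOA.
Variable R : realType.
Local Notation K := (R[i]).
Variable V : lmodType K.

Definition is_basis (P : V -> Prop) (d : nat) (b : 'I_d -> V) : Prop :=
  [/\ forall i, P (b i),
      forall v, P v -> exists a : 'I_d -> K, v = \sum_i a i *: b i
    & forall a : 'I_d -> K, \sum_i a i *: b i = 0 -> forall i, a i = 0].

Definition ptrace (P : V -> Prop) (f : V -> V) : K :=
  let B := epsilon (inhabits (existT (fun d => 'I_d -> V) 0%N (fun _ => 0)))
                   (fun B => is_basis P (projT2 B)) in
  \sum_(i < projT1 B)
     epsilon (inhabits (fun _ : 'I_(projT1 B) => (0 : K)))
       (fun a => f (projT2 B i) = \sum_j a j *: projT2 B j) i.

(* Y u k v = u_k v, i.e. Y(u,z) v = sum_k u_k v z^{-k-1};  L(n) = om_{n+1}. *)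
Variable Y : V -> int -> V -> V.
Variables (vac om : V) (c : K).
Variable proj : int -> V -> V.

Definition Lop (m : int) (v : V) : V := Y om (m + 1) v.

Definition homog (n : int) (v : V) : Prop := Lop 0 v = n%:~R *: v.

Definition is_VOA : Prop :=
  (forall a u1 u2 k w, Y (a *: u1 + u2) k w = a *: Y u1 k w + Y u2 k w) /\
  (forall a u k w1 w2, Y u k (a *: w1 + w2) = a *: Y u k w1 + Y u k w2) /\
  (forall u w, exists N : int, forall k, N <= k -> Y u k w = 0) /\
  (forall k w, Y vac k w = if k == -1 then w else 0) /\
  (forall u, Y u (-1) vac = u /\ forall k, 0 <= k -> Y u k vac = 0) /\
  (* Jacobi identity, in components (Borcherds identity) *)
  (forall u v w (p q r : int) (N : nat),
     (forall i : nat, (N <= i)%N ->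
        [/\ Y u (r + i%:Z) v = 0, Y v (q + i%:Z) w = 0 & Y u (p + i%:Z) w = 0]) ->
     \sum_(i < N) binz K p i *: Y (Y u (r + i%:Z) v) (p + q - i%:Z) w =
     \sum_(i < N) ((-1) ^+ i * binz K r i) *:
        (Y u (p + r - i%:Z) (Y v (q + i%:Z) w)
         - ((-1) ^ r) *: Y v (q + r - i%:Z) (Y u (p + i%:Z) w))) /\
  (forall (m n : int) w,
     Lop m (Lop n w) - Lop n (Lop m w) =
     (m - n)%:~R *: Lop (m + n) w
     + (if m + n == 0 then ((m ^+ 3 - m)%:~R / 12%:R * c) *: w else 0)) /\
  (forall u k w, Y (Lop (-1) u) k w = - (k%:~R *: Y u (k - 1) w)) /\
  homog 0 vac /\ homog 2 om /\
  (forall n a v1 v2, proj n (a *: v1 + v2) = a *: proj n v1 + proj n v2) /\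
  (forall n v, homog n (proj n v)) /\
  (forall n m v, homog m v -> proj n v = if n == m then v else 0) /\
  (forall v, exists B : nat, forall n, (B < absz n)%N -> proj n v = 0) /\
  (forall v, v = zsum (fun n => proj n v)) /\
  (forall n, exists d (b : 'I_d -> V),
      forall v, homog n v -> exists a : 'I_d -> K, v = \sum_i a i *: b i) /\
  (exists n0 : int, forall n v, n < n0 -> homog n v -> v = 0).

Definition is_inv_auto (t : V -> V) : Prop :=
  [/\ forall a v1 v2, t (a *: v1 + v2) = a *: t v1 + t v2,
      forall u k w, t (Y u k w) = Y (t u) k (t w),
      t vac = vac, t om = om & forall v, t (t v) = v].

(* truncated power series: e^{kz}, E(z) = (e^z - 1)/z, and E(z)^{-1} mod z^{d+1} *)
Definition expT (k : int) (d : nat) : {poly K} :=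
  \poly_(i < d.+1) ((k%:~R) ^+ i / (i`!)%:R).
Definition ET (d : nat) : {poly K} := \poly_(i < d.+1) ((i.+1)`!%:R)^-1.
Definition EinvT (d : nat) : {poly K} := \sum_(i < d.+1) (1 - ET d) ^+ i.
Definition Epow (e : int) (d : nat) : {poly K} :=
  match e with Posz m => ET d ^+ m | Negz m => EinvT d ^+ m.+1 end.

(* coefficient of z^{-m-1} in e^{kz} (e^z - 1)^{-j-1}, with j = m + d:
   = coefficient of z^d in e^{kz} E(z)^{-j-1} *)
Definition bcoef (k j : int) (d : nat) : K := (expT k d * Epow (- (j + 1)) d)`_d.

(* for u of weight k : u[m] w = sum_{j >= m} bcoef u_j w,
   i.e. Y[u,z] = Y(e^{z L(0)} u, e^z - 1) *)
Definition brk_h (k : int) (u : V) (m : int) (w : V) : V :=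
  nsum (fun i : nat => bcoef k (m + i%:Z) i *: Y u (m + i%:Z) w).

Definition brk (u : V) (m : int) (w : V) : V :=
  zsum (fun k => brk_h k (proj k u) m w).

Definition zmode (x : V) (w : V) : V := zsum (fun k => Y (proj k x) (k - 1) w).

(* q-expansion of Z_W(x, tau) = Tr_W o(x) q^{L(0) - c/24}:
   Zc P x N = coefficient of q^{N - c/24} = Tr_{W_N} o(x), W = {v | P v} *)
Definition Zc (P : V -> Prop) (x : V) (N : int) : K :=
  ptrace (fun w => homog N w /\ P w) (zmode x).

End VOA.

Section Eis.
Variable K : fieldType.

Fixpoint bern_seq (n : nat) : seq K :=
  match n with
  | 0 => [:: 1]
  | n'.+1 => let s := bern_seq n' in
      rcons s (- (\sum_(j < n'.+1) ('C(n'.+2, j))%:R * s`_j) / (n'.+2)%:R)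
  end.
(* Bernoulli numbers: sum_{j<=k} C(k+1,j) B_j = 0 (k >= 1), B_0 = 1 *)
Definition bern (k : nat) : K := (bern_seq k)`_k.

Definition sigmaK (r n : nat) : K := (\sum_(d <- divisors n) d ^ r)%:R.

(* coefficient of q^i in E_k(tau) *)
Definition Ec (k i : nat) : K :=
  if odd k then 0
  else if i == 0%N then - bern k / (k`!)%:R
  else 2%:R / ((k.-1)`!)%:R * sigmaK k.-1 i.

(* coefficient of q^i in F_k(tau) = 2 E_k(2 tau) - E_k(tau) *)
Definition Fc (k i : nat) : K := 2%:R * (if odd i then 0 else Ec k i./2) - Ec k i.

Definition gco (n m : nat) : K := (-1) ^+ m.+1 * ('C(n + m - 1, m))%:R.

(* coefficient of q^{N - c/24} in f(tau) * Z(tau), f a power series in q *)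
Definition qmul (f : nat -> K) (z : int -> K) (N : int) : K :=
  nsum (fun i : nat => f i * z (N - i%:Z)).
End Eis.

(* Main.v *)
(* Let s be the identity or t, so that s u = e u with e = 1 or -1.  With
   X_k(N) = tr s u_{a-1+k} v_{b-1-k} on V_N (a, b the weights of u, v) and X'_k(N) the
   same trace with u and v exchanged, the commutator formula expresses X_k - X'_k
   through the traces of u[m]v, m >= 0, while cyclicity of the trace gives
   X'_k(N) = e X_k(N - k).  Iterating these two relations yields X_k and X'_k as
   divisor sums.  The Borcherds identity for the kernel x/(x-1), whose expansion in
   z = log x has the Bernoulli numbers as coefficients, writes
   u[-1]v + sum_m B_{m+1}/(m+1)! u[m]v through X_{-i} and X'_{1+i}, i >= 0; this is
   the recursion for n = 1, with E_k for e = 1 and F_k for e = -1.  Replacing u by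
   L[-1]u, which has (L[-1]u)[m] = -m u[m-1] and vanishing zero mode, raises n by one.
   Finally the trace over V^+ is half the sum of the traces for s = id and s = t. *)
Require Import Defs.
From HB Require Import structures.
From mathcomp Require Import all_boot all_order all_algebra.
From mathcomp Require Import complex boolp reals zify ring.
From Stdlib Require Import ClassicalEpsilon Setoid Morphisms.
Import Order.TTheory GRing.Theory Num.Theory.
Set Implicit Arguments. Unset Strict Implicit. Unset Printing Implicit Defensive.
Local Open Scope ring_scope.

(** * Finitely supported sums *)

(** Everything is read one coefficient of q at a time. The weights are bounded below, say by n0, so
    traces over V_N with N < n0 vanish; the iteration stops after finitely many turns and no
    convergence enters. The direction matters: for l > 0 both X'_l and X_{-l} pass to lower weights,
    and the kernel x/(x-1) produces exactly these together with a lone X_0. Pairing X_{-l} with X'_l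
    cancels the even powers of l, which is why only even weights m+1 occur. At k = 0 the two
    relations degenerate to tr s o(u[0]v) = (1 - e) X_0. The kernel leaves X_0 minus half of this
    trace, the half being B_1 + 1, so (1 + e)/2 times X_0 survives: the term Tr o(u)o(v) for e = 1,
    nothing for e = -1. For e = 1 the same relation gives Z_V(u[0]v) = 0, so the second sum may
    start at m = 1. Sums and traces are defined by [epsilon], so their values are first tied to an
    actual bound or an actual basis; power series are truncated polynomials, compared modulo a power
    of z. *)

Section FiniteSums.
Variable X : zmodType.

Lemma sum_stable (a : nat -> X) (M M' : nat) :
  (forall i, (M <= i)%N -> a i = 0) -> (M <= M')%N ->
  \sum_(i < M') a i = \sum_(i < M) a i.
Proof.
move=> a0 leM; rewrite -!(big_mkord predT) (big_cat_nat (n:=M)) //=.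
by rewrite [X in _ + X]big_nat_cond [X in _ + X]big1 ?addr0 // => i /andP[/andP[/a0]].
Qed.

(** The bound picked by [epsilon] is a true bound as soon as one exists, and enlarging a bound only
    adds zeros; so any known bound may replace it. *)
Lemma nsumE (a : nat -> X) (M : nat) :
  (forall i, (M <= i)%N -> a i = 0) -> nsum a = \sum_(i < M) a i.
Proof.
move=> a0; rewrite /nsum; set P := fun M => _.
have a0' : P (nbound P) by apply: epsilon_spec; exists M.
have [le|/ltnW le] := leqP M (nbound P); first exact: sum_stable.
by symmetry; apply: sum_stable.
Qed.

Lemma zsum_stable (a : int -> X) (B B' : nat) :
  (forall k : int, (B < absz k)%N -> a k = 0) -> (B <= B')%N ->
  \sum_(i < B'.*2.+1) a (i%:Z - B'%:Z) = \sum_(i < B.*2.+1) a (i%:Z - B%:Z).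
Proof.
move=> a0 /subnK <-; elim: (B' - B)%N => [|d IH] //=.
rewrite -IH addSn doubleS big_ord_recr big_ord_recl /=.
rewrite !a0 ?add0r ?addr0; try lia.
by apply: eq_bigr => i _; congr a; rewrite /bump /=; lia.
Qed.

Lemma zsumE (a : int -> X) (B : nat) :
  (forall k : int, (B < absz k)%N -> a k = 0) ->
  zsum a = \sum_(i < B.*2.+1) a (i%:Z - B%:Z).
Proof.
move=> a0; rewrite /zsum; set P := fun M => _.
have a0' : P (nbound P) by apply: epsilon_spec; exists B.
have [le|/ltnW le] := leqP B (nbound P); first exact: zsum_stable.
by symmetry; apply: zsum_stable.
Qed.

Lemma eq_zsum (a b : int -> X) : (forall k, a k = b k) -> zsum a = zsum b.
Proof. by move=> /funext ->. Qed.

Lemma eq_nsum (a b : nat -> X) : (forall k, a k = b k) -> nsum a = nsum b.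
Proof. by move=> /funext ->. Qed.

Lemma zsum_single (a : int -> X) (k0 : int) :
  (forall k, k != k0 -> a k = 0) -> zsum a = a k0.
Proof.
move=> a0; rewrite (@zsumE _ (absz k0)); last first.
  by move=> k lt; apply: a0; apply/eqP => e; move: lt; rewrite e ltnn.
have lt : (absz (k0 + (absz k0)%:Z)%R < (absz k0).*2.+1)%N by lia.
rewrite (bigD1 (Ordinal lt)) //= big1 ?addr0 => [|i ne].
  by congr a; lia.
by apply: a0; apply: contra ne => /eqP e; apply/eqP/val_inj => /=; lia.
Qed.

Definition fsupp (a : nat -> X) := exists M : nat, forall i, (M <= i)%N -> a i = 0.
Definition fsuppz (a : int -> X) := exists B : nat, forall k, (B < absz k)%N -> a k = 0.

Lemma nsumD (a b : nat -> X) :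
  fsupp a -> fsupp b -> nsum (fun i => a i + b i) = nsum a + nsum b.
Proof.
move=> [M aM] [M' bM].
have a0 i : (maxn M M' <= i)%N -> a i = 0 by rewrite geq_max => /andP[/aM].
have b0 i : (maxn M M' <= i)%N -> b i = 0 by rewrite geq_max => /andP[_ /bM].
rewrite (nsumE a0) (nsumE b0) (@nsumE _ (maxn M M')) ?big_split // => i le.
by rewrite a0 ?b0 ?addr0.
Qed.

End FiniteSums.

Section Linear.
Variables (K : pzRingType) (V W : lmodType K).

Definition lin (f : V -> W) := forall a x y, f (a *: x + y) = a *: f x + f y.

Lemma lin0 f : lin f -> f 0 = 0.
Proof.
by move=> h; have := h (-1) 0 0; rewrite scaler0 addr0 scaleN1r addNr.
Qed.

Lemma linZ f a x : lin f -> f (a *: x) = a *: f x.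
Proof. by move=> h; rewrite -[a *: x]addr0 h lin0 ?addr0. Qed.

Lemma linD f x y : lin f -> f (x + y) = f x + f y.
Proof. by move=> h; rewrite -{1}[x]scale1r h scale1r. Qed.

Lemma linN f x : lin f -> f (- x) = - f x.
Proof. by move=> h; rewrite -scaleN1r linZ // scaleN1r. Qed.

Lemma lin_sum f I (r : seq I) (P : pred I) (F : I -> V) : lin f ->
  f (\sum_(i <- r | P i) F i) = \sum_(i <- r | P i) f (F i).
Proof.
move=> h; elim/big_rec2: _ => [|i y1 y2 _ <-]; first exact: lin0.
by rewrite linD.
Qed.

Lemma lin_nsum f (a : nat -> V) : lin f -> fsupp a ->
  f (nsum a) = nsum (fun i => f (a i)).
Proof.
move=> h [M a0]; rewrite (nsumE a0) lin_sum // (@nsumE _ _ M) // => i le.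
by rewrite a0 ?lin0.
Qed.

Lemma lin_zsum f (a : int -> V) : lin f -> fsuppz a ->
  f (zsum a) = zsum (fun i => f (a i)).
Proof.
move=> h [M a0]; rewrite (zsumE a0) lin_sum // (@zsumE _ _ M) // => i le.
by rewrite a0 ?lin0.
Qed.

End Linear.

Section LinearSums.
Variables (K : pzRingType) (V : lmodType K).

Lemma nsum_lin (c : K) (a b : nat -> V) : fsupp a -> fsupp b ->
  nsum (fun i => c *: a i + b i) = c *: nsum a + nsum b.
Proof.
move=> fa fb; rewrite nsumD //; last first.
  by case: fa => M h; exists M => i le; rewrite h ?scaler0.
case: fa => M a0; rewrite (nsumE a0) scaler_sumr (@nsumE _ _ M) // => i le.
by rewrite a0 ?scaler0.
Qed.

Lemma zsum_lin (c : K) (a b : int -> V) : fsuppz a -> fsuppz b ->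
  zsum (fun i => c *: a i + b i) = c *: zsum a + zsum b.
Proof.
move=> [M aM] [M' bM].
have a0 k : (maxn M M' < absz k)%N -> a k = 0.
  by rewrite gtn_max => /andP[/aM].
have b0 k : (maxn M M' < absz k)%N -> b k = 0.
  by rewrite gtn_max => /andP[_ /bM].
rewrite (zsumE a0) (zsumE b0) (@zsumE _ _ (maxn M M')).
  by rewrite big_split /= scaler_sumr.
by move=> i le; rewrite a0 ?b0 ?scaler0 ?addr0.
Qed.

End LinearSums.

(** * Power series modulo a power of the variable *)

Section Congruence.
Variables (A : comNzRingType) (d : nat).
Implicit Types p q : {poly A}.

(** Congruence modulo X^(d+1). Wrapping it in a constructor keeps it a relation for setoid rewriting
    with the instances below, instead of a family of coefficient equations. *)
Variant eqX p q : Prop := EqX of forall i, (i <= d)%N -> p`_i = q`_i.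

#[global] Instance eqX_equiv : Equivalence eqX.
Proof.
split=> [p|p q [h]|p q r [h] [h']]; apply: EqX => i le //; first by rewrite h.
by rewrite h ?h'.
Qed.

#[global] Instance eqX_mul : Proper (eqX ==> eqX ==> eqX) *%R.
Proof.
move=> p p' [hp] q q' [hq]; apply: EqX => i le; rewrite !coefM.
apply: eq_bigr => j _.
by rewrite hp ?hq //; have := ltn_ord j; lia.
Qed.

#[global] Instance eqX_add : Proper (eqX ==> eqX ==> eqX) +%R.
Proof.
by move=> p p' [hp] q q' [hq]; apply: EqX => i le; rewrite !coefD hp ?hq.
Qed.

#[global] Instance eqX_opp : Proper (eqX ==> eqX) -%R.
Proof. by move=> p p' [hp]; apply: EqX => i le; rewrite !coefN hp. Qed.

#[global] Instance eqX_scale c : Proper (eqX ==> eqX) ( *:%R c).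
Proof. by move=> p p' [hp]; apply: EqX => i le; rewrite !coefZ hp. Qed.

#[global] Instance eqX_exp : Proper (eqX ==> eq ==> eqX) (@GRing.exp {poly A}).
Proof.
move=> p q h n _ <-; elim: n => [|n IH]; first exact: EqX.
by rewrite !exprS; apply: eqX_mul.
Qed.

(** The Euler operator z d/dz: unlike d/dz it preserves the order of truncation, so it respects
    [eqX]. *)
Definition theta p := 'X * p^`().

Lemma coef_theta p i : (theta p)`_i = p`_i *+ i.
Proof. by rewrite /theta coefXM coef_deriv; case: i. Qed.

#[global] Instance eqX_theta : Proper (eqX ==> eqX) theta.
Proof. by move=> p p' [hp]; apply: EqX => i le; rewrite !coef_theta hp. Qed.

Lemma thetaM p q : theta (p * q) = theta p * q + p * theta q.
Proof. by rewrite /theta derivM mulrDr mulrA; congr (_ + _); rewrite mulrCA. Qed.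

Lemma eqX_inv_uniq p q r : eqX (p * q) 1 -> eqX (p * r) 1 -> eqX q r.
Proof.
move=> h h'; rewrite -[q]mulr1 -h' mulrCA mulrA [p * q]h mul1r; exact: EqX.
Qed.

Lemma eqX_cancel p pinv q r : eqX (p * pinv) 1 -> eqX (p * q) (p * r) -> eqX q r.
Proof.
move=> h h'; rewrite -[q]mul1r -[r]mul1r -h [p * pinv]mulrC -!mulrA h'.
exact: EqX.
Qed.

End Congruence.

Lemma eqX_le (A : comNzRingType) d D (p q : {poly A}) :
  (d <= D)%N -> eqX D p q -> eqX d p q.
Proof. by move=> le [h]; apply: EqX => i le'; apply: h; apply: leq_trans le. Qed.

Section Series.
Variable R : realType.
Local Notation K := (R[i]).

Lemma fact_neq0 n : (n`!)%:R != 0 :> K.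
Proof. by rewrite pnatr_eq0 -lt0n fact_gt0. Qed.

Section FixedPrecision.
Variable D : nat.
Local Notation "p =X q" := (eqX D p q) (at level 70).
Local Notation E := (ET R D).
Local Notation Ei := (EinvT R D).
Local Notation ex k := (expT R k D).
Local Notation Ep e := (Epow R e D).

Lemma coef_ET i : (i <= D)%N -> E`_i = ((i.+1)`!%:R)^-1.
Proof. by move=> le; rewrite coef_poly ltnS le. Qed.

Lemma coef_expT k i : (i <= D)%N -> (ex k)`_i = k%:~R ^+ i / (i`!)%:R.
Proof. by move=> le; rewrite coef_poly ltnS le. Qed.

(** [EinvT] is the geometric series in w = 1 - E. Since E has constant term 1, w is divisible by z
    and the remainder w^(D+1) is invisible at this precision. *)
Lemma ET_EinvT : E * Ei =X 1.
Proof.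
rewrite /EinvT; set w := 1 - E.
have -> : E = 1 - w by rewrite /w subKr.
have -> : (1 - w) * (\sum_(i < D.+1) w ^+ i) = 1 - w ^+ D.+1.
  by rewrite -opprB -[1 - w ^+ _]opprB subrX1 mulNr.
have : w`_0 = 0 by rewrite coefB coef_ET // coef1 factS fact0 invr1 subrr.
move: w => w w0.
have [s ->] : exists s, w = s * 'X.
  exists (drop_poly 1 w); rewrite -['X]expr1 -{1}(poly_take_drop 1 w).
  rewrite (_ : take_poly 1 w = 0) ?add0r // .
  by apply/polyP => -[|i]; rewrite coef_take_poly coef0.
apply: EqX => i le; rewrite coefB exprMn coefMXn ltnS le subr0 //.
Qed.

Lemma expTD k l : ex (k + l) =X ex k * ex l.
Proof.
apply: EqX => n le; rewrite coef_expT // coefM rmorphD /= addrC exprDn mulr_suml.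
apply: eq_bigr => i _; have lei : (i <= n)%N by rewrite -ltnS.
rewrite !coef_expT ?(leq_trans lei) //; last exact: leq_trans (leq_subr _ _) le.
rewrite -mulr_natr -(bin_fact lei) !natrM.
have := fact_neq0 i; have := fact_neq0 (n - i).
have : 'C(n, i)%:R != 0 :> K by rewrite pnatr_eq0 -lt0n bin_gt0.
by move=> h1 h2 h3; field; rewrite h1 h2 h3.
Qed.

Lemma expT0 : ex 0 =X 1.
Proof.
apply: EqX => i le; rewrite coef_expT // coef1; case: i le => [|i] le.
  by rewrite expr0 fact0 divr1.
by rewrite expr0n mul0r.
Qed.

Lemma expT1 : ex 1 =X 1 + 'X * E.
Proof.
apply: EqX => i le; rewrite coef_expT // expr1n coefD coef1 coefXM.
case: i le => [|i] le; first by rewrite fact0 divr1 addr0.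
by rewrite /= add0r coef_ET ?mul1r // ltnW.
Qed.

Lemma theta_expT k : theta (ex k) =X k%:~R *: ('X * ex k).
Proof.
apply: EqX => i le; rewrite coef_theta coefZ coefXM; case: i le => [|i] le.
  by rewrite mulr0n mulr0.
rewrite /= !coef_expT ?(ltnW le) // factS natrM exprS -[LHS]mulr_natr.
have : (i.+1)%:R != 0 :> K by rewrite pnatr_eq0.
move: (fact_neq0 i); move: (i.+1%:R : K) (i`!%:R : K) => x y hy hx.
by field; rewrite hx hy.
Qed.

(** This is z E = e^z - 1 differentiated: E + z E' = e^z. *)
Lemma theta_ET : theta E =X ex 1 - E.
Proof.
apply: EqX => i le; rewrite coef_theta coefB coef_ET // coef_expT // expr1n.
rewrite factS natrM -[LHS]mulr_natr.
have : (i.+1)%:R != 0 :> K by rewrite pnatr_eq0.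
have -> : i%:R = (i.+1)%:R - 1 :> K by rewrite -natr1 addrK.
move: (fact_neq0 i); move: (i.+1%:R : K) (i`!%:R : K) => x y hy hx.
by field; rewrite hx hy.
Qed.

Lemma EpowS e : Ep (e + 1) =X E * Ep e.
Proof.
case: e => [n|[|n]].
- have -> : n%:Z + 1 = n.+1%:Z by lia.
  by rewrite /= exprS.
- by rewrite /= expr0 expr1 ET_EinvT.
rewrite (_ : Negz n.+1 + 1 = Negz n); last by rewrite !NegzE; lia.
by rewrite /= [_ ^+ n.+2]exprS mulrA ET_EinvT mul1r.
Qed.

Lemma Epow_pred e : Ep (e - 1) =X Ei * Ep e.
Proof.
have := EpowS (e - 1); rewrite subrK => ->.
by rewrite mulrA [_ * E]mulrC ET_EinvT mul1r.
Qed.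

Lemma theta_Epow e : theta (Ep e) =X e%:~R *: (Ep (e - 1) * theta E).
Proof.
have E1 : Ep 1 = E by rewrite /= expr1.
elim/int_ind: e => [|n IH|n IH].
- by rewrite scale0r /= expr0 /theta derivC mulr0.
- rewrite intS addrC addrK EpowS thetaM IH.
  rewrite -scalerAr mulrA -EpowS subrK.
  by rewrite rmorphD /= scalerDl scale1r addrC [theta E * _]mulrC.
(* Downward step: the product rule for E^e = E * E^(e-1) determines the derivative of E^(e-1) up to
   the factor E, which is a unit. *)
apply: (eqX_cancel ET_EinvT); move: IH.
set e := - n%:Z => IH.
have -> : - n.+1%:Z = e - 1 by rewrite /e; lia.
have h := EpowS (e - 1); rewrite subrK in h.
have : theta E * Ep (e - 1) + E * theta (Ep (e - 1))
       =X e%:~R *: (Ep (e - 1) * theta E) by rewrite -thetaM -h.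
move=> h2.
rewrite -scalerAr [E * (_ * theta E)]mulrA -EpowS subrK rmorphB /= scalerBl scale1r -h2.
by rewrite [theta E * _]mulrC [_ * theta E + _]addrC addrK.
Qed.

Lemma theta_ETpow (k e : int) :
  theta (ex k * Ep e) =X
  k%:~R *: ('X * (ex k * Ep e)) + e%:~R *: (ex (k + 1) * Ep (e - 1))
  - e%:~R *: (ex k * Ep e).
Proof.
rewrite thetaM theta_expT theta_Epow theta_ET -addrA; apply: eqX_add.
  by rewrite -scalerAl mulrA.
rewrite expTD; have := EpowS (e - 1); rewrite subrK => ->.
by rewrite -scalerBr -scalerAr mulrBr mulrBr -!mulrA [_ * E]mulrC [Ep _ * ex 1]mulrC.
Qed.

(** * Bernoulli numbers as the coefficients of z/(e^z - 1) *)

Definition bernT : {poly K} := \poly_(i < D.+1) (bern K i / (i`!)%:R).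

Lemma size_bern_seq n : size (bern_seq K n) = n.+1.
Proof. by elim: n => //= n IH; rewrite size_rcons IH. Qed.

Lemma bern_seq_nth n j : (j <= n)%N -> (bern_seq K n)`_j = bern K j.
Proof.
elim: n => [|n IH]; first by rewrite leqn0 => /eqP->.
rewrite leq_eqVlt => /orP[/eqP->//|]; rewrite ltnS => le.
by rewrite /= nth_rcons size_bern_seq ltnS le IH.
Qed.

Lemma bern_rec n : \sum_(j < n.+2) 'C(n.+2, j)%:R * bern K j = 0.
Proof.
rewrite big_ord_recr /= {2}/bern /= nth_rcons size_bern_seq ltnn eqxx.
rewrite (eq_bigr (fun j : 'I_n.+1 => 'C(n.+2, j)%:R * (bern_seq K n)`_j)).
  rewrite binSn [X in _ + X]mulrC -mulrA mulVf ?pnatr_eq0 // mulr1; exact: subrr.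
by move=> j _; rewrite bern_seq_nth // -ltnS.
Qed.

Lemma coef_bernT i : (i <= D)%N -> bernT`_i = bern K i / (i`!)%:R.
Proof. by move=> le; rewrite coef_poly ltnS le. Qed.

Lemma ET_bernT : E * bernT =X 1.
Proof.
apply: EqX => n le; rewrite mulrC coefM coef1.
transitivity ((\sum_(j < n.+1) 'C(n.+1, j)%:R * bern K j) / (n.+1)`!%:R).
  rewrite mulr_suml; apply: eq_bigr => j _.
  have lej : (j <= n)%N by rewrite -ltnS.
  rewrite coef_bernT ?(leq_trans lej) // coef_ET; last first.
    exact: leq_trans (leq_subr _ _) le.
  rewrite -subSn // -(bin_fact (leqW lej)) !natrM.
  have := fact_neq0 j; have := fact_neq0 (n.+1 - j).
  have : 'C(n.+1, j)%:R != 0 :> K by rewrite pnatr_eq0 -lt0n bin_gt0 leqW.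
  by move=> h1 h2 h3; field; rewrite h1 h2 h3.
case: n le => [|n] le; last by rewrite bern_rec mul0r.
by rewrite big_ord1 bin0 mul1r factS fact0 muln1 divr1.
Qed.

Lemma EinvT_bernT : Ei =X bernT.
Proof. exact: (eqX_inv_uniq ET_EinvT ET_bernT). Qed.

(** z e^z/(e^z-1) = z/(e^z-1) + z. The extra ['X] turns B_1 = -1/2 into +1/2 and is the source of
    the indicator of m = 1 in the kernel sums. *)
Lemma expT1_EinvT : ex 1 * Ei =X bernT + 'X.
Proof.
by rewrite expT1 mulrDl mul1r -mulrA ET_EinvT mulr1 EinvT_bernT.
Qed.

End FixedPrecision.

Lemma coef_comp_oppX (p : {poly K}) i : (p \Po (- 'X))`_i = (-1) ^+ i * p`_i.
Proof.
have opX j : (- 'X : {poly K}) ^+ j = (-1) ^+ j *: 'X^j.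
  by rewrite -scaleN1r exprZn.
rewrite comp_polyE coef_sum; have [lt|ge] := ltnP i (size p); last first.
  rewrite [p`_i]nth_default // mulr0 big1 // => j _.
  rewrite opX !coefZ coefXn (_ : (i == j) = false) ?mulr0 //.
  by apply/negbTE; rewrite gtn_eqF // (leq_trans (ltn_ord j)).
rewrite (bigD1 (Ordinal lt)) //= big1 ?addr0 => [|j ne].
  by rewrite opX !coefZ coefXn eqxx mulr1 mulrC.
rewrite opX !coefZ coefXn (_ : (i == j) = false) ?mulr0 //.
by apply: contraNF ne => /eqP e; apply/eqP/val_inj.
Qed.

Lemma eqX_comp_oppX d (p q : {poly K}) :
  eqX d p q -> eqX d (p \Po (- 'X)) (q \Po (- 'X)).
Proof. by case=> h; apply: EqX => i le; rewrite !coef_comp_oppX h. Qed.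

Lemma expT_opp d k : eqX d (expT R k d \Po (- 'X)) (expT R (- k) d).
Proof.
apply: EqX => i le; rewrite coef_comp_oppX !coef_expT // mulrA rmorphN /=.
by rewrite [in RHS]exprNn.
Qed.

Lemma eqX_mulX d (p q : {poly K}) : eqX d.+1 ('X * p) ('X * q) -> eqX d p q.
Proof.
case=> h; apply: EqX => i le; by have := h i.+1 le; rewrite !coefXM.
Qed.

Lemma ET_eqX d D : (d <= D)%N -> eqX d (ET R D) (ET R d).
Proof.
by move=> le; apply: EqX => i le'; rewrite !coef_ET // (leq_trans le').
Qed.

Lemma expT_eqX d D k : (d <= D)%N -> eqX d (expT R k D) (expT R k d).
Proof.
by move=> le; apply: EqX => i le'; rewrite !coef_expT // (leq_trans le').
Qed.

(** Comes from (1 - e^{-z}) e^z = e^z - 1 after division by z. *)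
Lemma ET_comp_opp d : eqX d ((ET R d \Po (- 'X)) * expT R 1 d) (ET R d).
Proof.
(* One extra order of precision, because cancelling the factor z loses one. *)
set D := d.+1.
have h : eqX D ((ET R D \Po (- 'X)) * 'X * expT R 1 D) ('X * ET R D).
  have e1 := eqX_comp_oppX (expT1 D).
  rewrite expT_opp comp_polyD comp_polyM comp_polyX comp_polyC in e1.
  have e2 : eqX D ((ET R D \Po (- 'X)) * 'X) (1 - expT R (-1) D).
    by rewrite e1 mulNr opprD addNKr opprK mulrC.
  by rewrite e2 mulrBl -expTD addNr expT0 mul1r expT1 [1 + _]addrC addrK.
have le : (d <= D)%N by exact: leqnSn.
move: h; rewrite [_ * 'X]mulrC -mulrA => /eqX_mulX h.
have e := eqX_comp_oppX (ET_eqX le).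
by rewrite e (expT_eqX 1 le) (ET_eqX le) in h.
Qed.

(** Both sides are inverse to E(-z). Comparing odd coefficients beyond the first makes the odd
    Bernoulli numbers vanish. *)
Lemma bernT_opp d : eqX d (bernT d \Po (- 'X)) (bernT d + 'X).
Proof.
have h1 := eqX_comp_oppX (ET_bernT d).
rewrite comp_polyM comp_polyC in h1.
apply: (eqX_inv_uniq h1); rewrite -expT1_EinvT mulrA ET_comp_opp.
exact: ET_EinvT.
Qed.

Lemma bern_odd n : odd n -> (1 < n)%N -> bern K n = 0.
Proof.
move=> on n1; case: (bernT_opp n) => /(_ n (leqnn n)).
rewrite coef_comp_oppX coefD coefX coef_bernT // gtn_eqF // addr0.
rewrite -signr_odd on expr1 mulN1r => /eqP; rewrite eq_sym -subr_eq0 opprK.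
rewrite -mulr2n mulrn_eq0 /= mulf_eq0 invr_eq0 (negbTE (fact_neq0 n)) orbF.
by move/eqP.
Qed.

Lemma Epow_eqX d D e : (d <= D)%N -> eqX d (Epow R e D) (Epow R e d).
Proof.
move=> le.
have i : eqX d (EinvT R D) (EinvT R d).
  apply: (eqX_inv_uniq (p := ET R d)); last exact: ET_EinvT.
  by rewrite -(ET_eqX le); exact: eqX_le le (ET_EinvT D).
case: e => n /=; last by rewrite i.
by rewrite (ET_eqX le).
Qed.

(** Each [bcoef] is defined at its own precision d; this brings coefficients with different d to one
    common precision D, where series identities can relate them. *)
Lemma bcoefE k j d D : (d <= D)%N ->
  bcoef R k j d = (expT R k D * Epow R (- (j + 1)) D)`_d.
Proof.
move=> le.
have : eqX d (expT R k D * Epow R (- (j + 1)) D)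
             (expT R k d * Epow R (- (j + 1)) d).
  by rewrite (expT_eqX k le) (Epow_eqX _ le).
by case=> ->.
Qed.

Lemma bcoef0 k j : bcoef R k j 0 = 1.
Proof.
have E0 e : (Epow R e 0)`_0 = 1.
  have h : eqX 0 (ET R 0) 1.
    by apply: EqX => i; rewrite leqn0 => /eqP ->; rewrite coef_ET // coef1 invr1.
  have h' : eqX 0 (EinvT R 0) 1.
    by have := ET_EinvT 0; rewrite h mul1r.
  have : eqX 0 (Epow R e 0) 1.
    by case: e => n /=; rewrite ?h ?h' expr1n; apply: EqX.
  by case=> -> //; rewrite coef1.
by rewrite /bcoef coefM big_ord1 E0 coef_expT // mulr1 expr0 fact0 divr1.
Qed.

(* [z^{d+1}] of z times the derivative of e^{az} (e^z - 1)^{-j-1}. *)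
Lemma bcoef_deriv (a m : int) d :
  a%:~R * bcoef R a (m + d%:Z) d
    - (m + d%:Z + 1)%:~R * bcoef R (a + 1) (m + d%:Z + 1) d.+1
  = - (m%:~R * bcoef R a (m + d%:Z) d.+1).
Proof.
have := theta_ETpow d.+1 a (- (m + d%:Z + 1)).
case=> /(_ d.+1 (leqnn _)).
rewrite coef_theta !coefB coefD !coefZ coefXM /=.
rewrite -!bcoefE // -opprD -bcoefE // rmorphN /=.
rewrite -[in LHS]mulr_natr.
have -> : (m + d%:Z + 1)%:~R = m%:~R + d.+1%:R :> K.
  by rewrite -addrA intrD -[d%:Z + 1]/(d + 1)%:Z addn1.
set z := bcoef _ a _ d.+1; set x := bcoef _ a _ d; set y := bcoef _ (a + 1) _ _ => h.
have -> : a%:~R * x = z * d.+1%:R + (m%:~R + d.+1%:R) * y - (m%:~R + d.+1%:R) * z.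
  by rewrite h; ring.
by ring.
Qed.

Lemma binz0 r : binz K r 0 = 1.
Proof. by rewrite /binz big_ord0 fact0 divr1. Qed.

Lemma binzS r i : binz K (r + 1) i.+1 = binz K r i.+1 + binz K r i.
Proof.
rewrite /binz big_ord_recl big_ord_recr /= subr0.
under eq_bigr => j _ do
  rewrite /bump /= add1n -natr1 rmorphD /= opprD addrACA subrr addr0.
rewrite factS natrM.
have : (i.+1)%:R != 0 :> K by rewrite pnatr_eq0.
have -> : i%:R = (i.+1)%:R - 1 :> K by rewrite -natr1 addrK.
rewrite rmorphD /=; move: (fact_neq0 i) (\prod_(_ < i) _).
move: (i.+1%:R : K) (i`!%:R : K) (r%:~R : K) => x y r' hy P hx.
by field; rewrite hx hy.
Qed.

(* Residue of e^{rz} dz / (e^z - 1)^{i+1} at 0, i.e. of (1+x)^{r-1} x^{-i-1} dx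
   after x = e^z - 1. *)
Lemma bcoef_diag (r : int) i : bcoef R r i%:Z i = binz K (r - 1) i.
Proof.
elim: i r => [|i IH] r; first by rewrite bcoef0 binz0.
(* [g r] is the residue of e^{rz} dz/(e^z-1)^{i+2}. Writing e^{(s+1)z} = e^{sz}(1 + (e^z-1)) gives
   Pascal's rule in r, and at r = 1 the form is exact, so [g 1 = 0]; these two facts fix [g] on all
   integers. *)
pose g r := bcoef R r i.+1%:Z i.+1.
have gS s : g (s + 1) = g s + bcoef R s i%:Z i.
  have hX (p : {poly K}) : p`_i = ('X * p)`_i.+1 by rewrite coefXM.
  rewrite /g !(@bcoefE _ _ _ i.+1) // [X in _ = _ + X]hX -coefD.
  suff : eqX i.+1 (expT R (s + 1) i.+1 * Epow R (- (i.+1%:Z + 1)) i.+1)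
    (expT R s i.+1 * Epow R (- (i.+1%:Z + 1)) i.+1 +
     'X * (expT R s i.+1 * Epow R (- (i%:Z + 1)) i.+1)) by case=> ->.
  rewrite expTD expT1; have := EpowS i.+1 (- (i.+1%:Z + 1)).
  rewrite (_ : - (i.+1%:Z + 1) + 1 = - (i%:Z + 1)); last by lia.
  by move=> ->; apply: EqX => k _; congr (nth _ (polyseq _) _); ring.
have g1 : g 1 = 0.
  have := bcoef_deriv 0 0 i; have -> : 0 + i%:Z + 1 = i.+1%:Z by lia.
  rewrite !mulr0z !mul0r !add0r oppr0 => /eqP.
  by rewrite oppr_eq0 mulf_eq0 pnatr_eq0 /= => /eqP.
rewrite -/(g r) -[in LHS](subrK 1 r); elim/int_ind: (r - 1) => [|n IHn|n IHn].
- by rewrite add0r g1 /binz big_ord_recl subrr mul0r mul0r.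
- rewrite intS [1 + _]addrC gS IHn binzS; congr (_ + _).
  by rewrite IH addrK.
have e : - n%:Z = - n.+1%:Z + 1 by lia.
move: IHn; rewrite e gS binzS IH addrK => /addIr; exact.
Qed.

(* [m]-mode expansion of the residue of e^{kz} Y[u,z]. *)
Lemma bcoef_exp_sum (a k : int) i :
  \sum_(m < i.+1) (k%:~R ^+ m / (m`!)%:R) * bcoef R a i%:Z (i - m)
  = binz K (a + k - 1) i.
Proof.
rewrite -bcoef_diag (bcoefE _ _ (leqnn i)).
have -> : (expT R (a + k) i * Epow R (- (i%:Z + 1)) i)`_i =
  (expT R k i * (expT R a i * Epow R (- (i%:Z + 1)) i))`_i.
  have : eqX i (expT R (a + k) i * Epow R (- (i%:Z + 1)) i)
    (expT R k i * (expT R a i * Epow R (- (i%:Z + 1)) i)).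
    by rewrite addrC expTD mulrA.
  by case=> ->.
rewrite coefM; apply: eq_bigr => m _; have le : (m <= i)%N by rewrite -ltnS.
by rewrite coef_expT // (@bcoefE _ _ _ i) // leq_subr.
Qed.

(* Expansion of x/(x-1) = e^z/(e^z-1) in powers of z = log x. *)
Lemma bcoef_bern_sum (a : int) i :
  \sum_(m < i.+1) (bern K m / (m`!)%:R + (m == 1%N :> nat)%:R)
      * bcoef R a (i%:Z - 1) (i - m)
  = binz K a i.
Proof.
rewrite -[a in RHS](addrK 1) -bcoef_diag (bcoefE _ _ (leqnn i)).
have -> : (expT R (a + 1) i * Epow R (- (i%:Z + 1)) i)`_i =
  ((bernT i + 'X) * (expT R a i * Epow R (- (i%:Z - 1 + 1)) i))`_i.
  have : eqX i (expT R (a + 1) i * Epow R (- (i%:Z + 1)) i)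
    ((bernT i + 'X) * (expT R a i * Epow R (- (i%:Z - 1 + 1)) i)).
    rewrite subrK expTD -expT1_EinvT.
    have -> : - (i%:Z + 1) = - i%:Z - 1 by lia.
    by rewrite Epow_pred; apply: EqX => k _; congr (nth _ (polyseq _) _); ring.
  by case=> ->.
rewrite coefM; apply: eq_bigr => m _; have le : (m <= i)%N by rewrite -ltnS.
by rewrite coefD coefX coef_bernT // (@bcoefE _ _ _ i) // leq_subr.
Qed.

End Series.

(** * Traces on finite-dimensional subspaces *)

Section Trace.
Variables (R : realType) (V : lmodType R[i]).
Local Notation K := (R[i]).
Implicit Types (P Q : V -> Prop) (f g : V -> V).

Definition subsp P := P 0 /\ forall a x y, P x -> P y -> P (a *: x + y).
Definition indep k (f : 'I_k -> V) :=
  forall a : 'I_k -> K, \sum_i a i *: f i = 0 -> forall i, a i = 0.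
Definition findim P := exists d (b : 'I_d -> V), is_basis P b.
Definition stable P f := forall v, P v -> P (f v).

(** If k > d, the k by d coordinate matrix has a nonzero row vector in its left kernel, which is a
    linear relation among the f_i. *)
Lemma indep_le d (b : 'I_d -> V) k (f : 'I_k -> V) : indep f ->
  (forall i, exists a : 'I_d -> K, f i = \sum_j a j *: b j) -> (k <= d)%N.
Proof.
move=> fi /choice[A fA]; rewrite leqNgt; apply/negP => lt.
pose M := \matrix_(i, j) A i j; pose x := nz_row (kermx M).
have x0 : x != 0.
  rewrite nz_row_eq0 -mxrank_eq0 mxrank_ker -lt0n subn_gt0.
  exact: leq_ltn_trans (rank_leq_col _) lt.
have xM : x *m M = 0 by apply/sub_kermxP; exact: nz_row_sub.
move/eqP: x0; apply; apply/rowP => i; rewrite mxE.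
apply: (fi (fun i => x 0 i)).
under eq_bigr => j _ do rewrite fA scaler_sumr.
rewrite exchange_big /= big1 // => j _.
under eq_bigr => l _ do rewrite scalerA.
rewrite -scaler_suml; suff -> : \sum_l x 0 l * A l j = 0 by rewrite scale0r.
have := congr1 (fun N : 'rV_d => N 0 j) xM; rewrite !mxE => h; rewrite -[RHS]h.
by apply: eq_bigr => l _; rewrite [M _ _]mxE.
Qed.

(** The vectors b need not lie in P. A longest independent family inside P is a basis: adjoining v
    in P forces a relation, and its coefficient at v is nonzero. *)
Lemma findim_sub P d (b : 'I_d -> V) :
  (forall v, P v -> exists a : 'I_d -> K, v = \sum_i a i *: b i) -> findim P.
Proof.
move=> span.
pose good k := `[< exists f : 'I_k -> V, (forall i, P (f i)) /\ indep f >].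
have ex : exists k, good k.
  by exists 0%N; apply/asboolP; exists (fun _ => 0); split=> [[]|a _ []].
have bd k : good k -> (k <= d)%N.
  by move/asboolP=> [f [fP fi]]; apply: (indep_le fi (b := b)) => i; apply: span.
case: (ex_maxnP ex bd) => k /asboolP[f [fP fi]] kmax.
exists k, f; split=> // v Pv.
pose g (i : 'I_k.+1) := oapp f v (unlift ord0 i).
have g0 : g ord0 = v by rewrite /g unlift_none.
have gS i : g (lift ord0 i) = f i by rewrite /g liftK.
have gP i : P (g i) by rewrite /g; case: (unlift _ _).
have : ~ indep g.
  move=> gi; have /kmax : good k.+1 by apply/asboolP; exists g.
  by rewrite ltnn.
move/existsNP => [a /not_implyP[]]; rewrite big_ord_recl g0.
under eq_bigr => i _ do rewrite gS.
move=> sum0 /existsNP[i0 ai0].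
have a0 : a ord0 != 0.
  apply/eqP => a0; apply: ai0; case: (unliftP ord0 i0) => [j|] -> //.
  by rewrite a0 scale0r add0r in sum0; exact: (fi (fun j => a (lift ord0 j))).
exists (fun j => - (a ord0)^-1 * a (lift ord0 j)).
under eq_bigr => j _ do rewrite -scalerA.
rewrite -scaler_sumr; move/eqP: sum0; rewrite addr_eq0 => /eqP.
move/(congr1 (fun w => (a ord0)^-1 *: w)); rewrite scalerA mulVf // scale1r => ->.
by rewrite scalerN scaleNr.
Qed.

Lemma ptrace_basis P : findim P -> exists d (b : 'I_d -> V), is_basis P b /\
  forall f, ptrace P f = \sum_i epsilon (inhabits (fun _ : 'I_d => 0 : K))
    (fun a => f (b i) = \sum_j a j *: b j) i.
Proof.
move=> [d [b hb]].
pose Q (B : {d : nat & 'I_d -> V}) := is_basis P (projT2 B).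
have ex : exists B, Q B by exists (existT (fun d => 'I_d -> V) d b).
have := epsilon_spec (inhabits (existT (fun d => 'I_d -> V) 0%N (fun _ => 0))) Q ex.
rewrite /Q; set B := epsilon _ _ => hB.
by exists (projT1 B), (projT2 B).
Qed.

Lemma ptrace_ext P f g : findim P -> (forall v, P v -> f v = g v) ->
  ptrace P f = ptrace P g.
Proof.
move=> /ptrace_basis[d [b [[bP _ _] tE]]] fg.
by rewrite !tE; apply: eq_bigr => i _; rewrite fg.
Qed.

(** The basis depends on P alone and is fixed before f, so traces of several operators are computed
    in the same basis; independence forces the coordinates picked by [epsilon] to be those of M. *)
Lemma ptraceE P : findim P -> exists d (b : 'I_d -> V), is_basis P b /\
  forall f (M : 'M_d), (forall i, f (b i) = \sum_j M i j *: b j) -> ptrace P f = \tr M.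
Proof.
move=> /ptrace_basis[d [b [hb tE]]]; exists d, b; split=> // f M fM.
rewrite tE; apply: eq_bigr => i _.
pose Q (a : 'I_d -> K) := f (b i) = \sum_j a j *: b j.
have ex : exists a, Q a by exists (M i).
have := epsilon_spec (inhabits (fun _ : 'I_d => 0 : K)) Q ex.
rewrite -/Q; set a := epsilon _ _; rewrite /Q => ha.
have [_ _ /(_ (fun j => a j - M i j))] := hb.
under eq_bigr => j _ do rewrite scalerBl.
rewrite sumrB -ha -fM subrr => /(_ erefl i) /eqP.
by rewrite subr_eq0 => /eqP.
Qed.

Lemma stable_matrix P d (b : 'I_d -> V) f : is_basis P b -> stable P f ->
  exists M : 'M_d, forall i, f (b i) = \sum_j M i j *: b j.
Proof.
move=> [bP bS _] fP.
have /choice[A hA] : forall i, exists a : 'I_d -> K, f (b i) = \sum_j a j *: b j.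
  by move=> i; apply/bS/fP/bP.
exists (\matrix_(i, j) A i j) => i; rewrite hA.
by apply: eq_bigr => j _; rewrite mxE.
Qed.

Lemma ptrace_lin P f g (a : K) : findim P -> stable P f -> stable P g ->
  ptrace P (fun v => a *: f v + g v) = a * ptrace P f + ptrace P g.
Proof.
move=> /ptraceE[d [b [hb tE]]] fP gP.
have [M hM] := stable_matrix hb fP; have [N hN] := stable_matrix hb gP.
rewrite (tE _ _ hM) (tE _ _ hN) (tE _ (a *: M + N)) ?mxtraceD ?mxtraceZ //.
move=> i; rewrite hM hN scaler_sumr -big_split; apply: eq_bigr => j _ /=.
by rewrite !mxE scalerDl scalerA.
Qed.

Lemma ptrace0 P : findim P -> ptrace P (fun _ => 0) = 0.
Proof.
move=> /ptraceE[d [b [hb tE]]]; rewrite (tE _ 0) ?mxtrace0 // => i.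
by rewrite big1 // => j _; rewrite mxE scale0r.
Qed.

(** Two different spaces are allowed, so that the matrices are rectangular: it serves modes that
    shift the weight and also the inclusion of V^+ in V. *)
Lemma ptrace_cyclic P Q f g : findim P -> findim Q -> lin f -> lin g ->
  (forall v, P v -> Q (f v)) -> (forall v, Q v -> P (g v)) ->
  ptrace P (fun v => g (f v)) = ptrace Q (fun v => f (g v)).
Proof.
move=> /ptraceE[d [b [hb tE]]] /ptraceE[d' [b' [hb' tE']]] lf lg fP gQ.
have [bP bS _] := hb; have [bP' bS' _] := hb'.
have /choice[M hM] : forall i, exists a : 'I_d' -> K, f (b i) = \sum_j a j *: b' j.
  by move=> i; apply/bS'/fP/bP.
have /choice[N hN] : forall i, exists a : 'I_d -> K, g (b' i) = \sum_j a j *: b j.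
  by move=> i; apply/bS/gQ/bP'.
pose A := \matrix_(i, j) M i j; pose B := \matrix_(i, j) N i j.
rewrite (tE _ (A *m B)) => [|i]; last first.
  rewrite /= hM lin_sum //; under [LHS]eq_bigr => j _ do rewrite (linZ _ _ lg) hN scaler_sumr.
  rewrite exchange_big; apply: eq_bigr => j _ /=; rewrite mxE scaler_suml.
  by apply: eq_bigr => l _; rewrite !mxE scalerA.
rewrite (tE' _ (B *m A)) => [|i]; first exact: mxtrace_mulC.
rewrite /= hN lin_sum //; under [LHS]eq_bigr => j _ do rewrite (linZ _ _ lf) hM scaler_sumr.
rewrite exchange_big; apply: eq_bigr => j _ /=; rewrite mxE scaler_suml.
by apply: eq_bigr => l _; rewrite !mxE scalerA.
Qed.

End Trace.

(** * Modes of a vertex operator algebra *)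

Lemma binz_0 (F : fieldType) i : binz F 0 i.+1 = 0.
Proof. by rewrite /binz big_ord_recl subrr mul0r mul0r. Qed.

Lemma binz_m1 (R : realType) i : binz R[i] (-1) i = (-1) ^+ i.
Proof.
elim: i => [|i IH]; first by rewrite binz0.
have := binzS R (-1) i; rewrite addNr binz_0 IH => /eqP.
by rewrite eq_sym addr_eq0 exprS mulN1r => /eqP.
Qed.

Lemma sum_triangle (X : zmodType) (F : nat -> nat -> X) M :
  \sum_(m < M) \sum_(d < M - m) F m (m + d)%N = \sum_(i < M) \sum_(m < i.+1) F m i.
Proof.
elim: M => [|M IH]; first by rewrite !big_ord0.
rewrite [RHS]big_ord_recr /= -IH [LHS]big_ord_recr /= subSnn big_ord1 addn0.
rewrite [in RHS]big_ord_recr /= addrA -big_split /=; congr (_ + _).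
apply: eq_bigr => m _; rewrite subSn ?(ltnW (ltn_ord m)) // big_ord_recr /=.
by rewrite subnKC // ltnW.
Qed.

Section VOA.
Variables (R : realType) (V : lmodType R[i]).
Local Notation K := (R[i]).
Variables (Y : V -> int -> V -> V) (vac om : V) (c : K) (proj : int -> V -> V).
Hypothesis HV : is_VOA Y vac om c proj.
Local Notation hom := (homog Y om).
Local Notation L := (Lop Y om).
Local Notation brk := (brk Y proj).
Local Notation brk_h := (brk_h Y).
Local Notation zmode := (zmode Y proj).

Lemma Y_linl k w : lin (fun u => Y u k w).
Proof. by case: HV => h _ a x y; exact: h. Qed.

Lemma Y_linr u k : lin (Y u k).
Proof. by case: HV => _ [h _] a x y; exact: h. Qed.

Lemma Y_trunc u k w : exists M : nat, forall i, (M <= i)%N -> Y u (k + i%:Z) w = 0.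
Proof.
case: HV => _ [_ [/(_ u w)[N h] _]]; exists (absz (N - k)) => i le.
by apply: h; lia.
Qed.

Lemma borcherds u v w (p q r : int) (N : nat) :
  (forall i : nat, (N <= i)%N ->
     [/\ Y u (r + i%:Z) v = 0, Y v (q + i%:Z) w = 0 & Y u (p + i%:Z) w = 0]) ->
  \sum_(i < N) binz K p i *: Y (Y u (r + i%:Z) v) (p + q - i%:Z) w =
  \sum_(i < N) ((-1) ^+ i * binz K r i) *:
     (Y u (p + r - i%:Z) (Y v (q + i%:Z) w)
      - ((-1) ^ r) *: Y v (q + r - i%:Z) (Y u (p + i%:Z) w)).
Proof. by case: HV => _ [_ [_ [_ [_ [h _]]]]]; exact: h. Qed.

Lemma Y_Lm1 u k w : Y (L (-1) u) k w = - (k%:~R *: Y u (k - 1) w).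
Proof. by case: HV => _ [_ [_ [_ [_ [_ [_ [h _]]]]]]]; exact: h. Qed.

Lemma proj_lin n : lin (proj n).
Proof. by case: HV => _ [_ [_ [_ [_ [_ [_ [_ [_ [_ [h _]]]]]]]]]] a x y; exact: h. Qed.

Lemma proj_hom n v : hom n (proj n v).
Proof. by case: HV => _ [_ [_ [_ [_ [_ [_ [_ [_ [_ [_ [h _]]]]]]]]]]]; exact: h. Qed.

Lemma proj_id n m v : hom m v -> proj n v = if n == m then v else 0.
Proof. by case: HV => _ [_ [_ [_ [_ [_ [_ [_ [_ [_ [_ [_ [h _]]]]]]]]]]]]; exact: h. Qed.

Lemma proj_supp v : fsuppz (fun n => proj n v).
Proof.
by case: HV => _ [_ [_ [_ [_ [_ [_ [_ [_ [_ [_ [_ [_ [h _]]]]]]]]]]]]]; exact: h.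
Qed.

Lemma proj_sum v : v = zsum (fun n => proj n v).
Proof.
by case: HV => _ [_ [_ [_ [_ [_ [_ [_ [_ [_ [_ [_ [_ [_ [h _]]]]]]]]]]]]]]; exact: h.
Qed.

Lemma hom_span n : exists d (b : 'I_d -> V),
  forall v, hom n v -> exists a : 'I_d -> K, v = \sum_i a i *: b i.
Proof.
by case: HV => _ [_ [_ [_ [_ [_ [_ [_ [_ [_ [_ [_ [_ [_ [_ [h _]]]]]]]]]]]]]]]; exact: h.
Qed.

Lemma hom_low : exists n0 : int, forall n v, n < n0 -> hom n v -> v = 0.
Proof.
by case: HV => _ [_ [_ [_ [_ [_ [_ [_ [_ [_ [_ [_ [_ [_ [_ [_ h]]]]]]]]]]]]]]]; exact: h.
Qed.

Lemma hom_subsp n : subsp (hom n).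
Proof.
split=> [|a x y hx hy].
  by rewrite /homog /Lop (lin0 (Y_linr _ _)) scaler0.
rewrite /homog /Lop in hx hy *; rewrite Y_linr hx hy scalerDr.
by rewrite scalerA mulrC -scalerA.
Qed.

Lemma hom0 n : hom n 0. Proof. by case: (hom_subsp n). Qed.

Lemma homD n x y : hom n x -> hom n y -> hom n (x + y).
Proof. by move=> hx hy; rewrite -[x]scale1r; apply: (hom_subsp n).2. Qed.

Lemma homZ n a x : hom n x -> hom n (a *: x).
Proof. by move=> hx; rewrite -[a *: x]addr0; apply: (hom_subsp n).2 => //; exact: hom0. Qed.

Lemma hom_findim n : findim (hom n).
Proof. by have [d [b h]] := hom_span n; apply: (findim_sub (b := b)) h. Qed.

Lemma hom_zsum n (a : int -> V) : fsuppz a -> (forall k, hom n (a k)) ->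
  hom n (zsum a).
Proof.
move=> [B a0] ha; rewrite (zsumE a0); elim/big_ind: _ => //; first exact: hom0.
by move=> x y; apply: homD.
Qed.

(** The Borcherds identity at r = 0, where [binz 0] kills every term on the right except i = 0. *)
Lemma commutator u v p q w M : (forall i, (M <= i)%N -> Y u i%:Z v = 0) ->
  Y u p (Y v q w) - Y v q (Y u p w) =
  \sum_(i < M) binz K p i *: Y (Y u i%:Z v) (p + q - i%:Z) w.
Proof.
move=> uv0; have [M1 h1] := Y_trunc v q w; have [M2 h2] := Y_trunc u p w.
pose N := (M + M1 + M2).+1.
have bd (i : nat) : (N <= i)%N ->
    [/\ Y u (0 + i%:Z) v = 0, Y v (q + i%:Z) w = 0 & Y u (p + i%:Z) w = 0].
  by move=> le; split; [rewrite add0r; apply: uv0|apply: h1|apply: h2]; lia.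
have := borcherds bd; rewrite [in RHS]big_ord_recl [X in _ = _ + X]big1 => [|i _].
  rewrite addr0 binz0 /= expr0 mul1r scale1r expr0z scale1r.
  have -> : p + 0 - 0%:Z = p by lia.
  have -> : q + 0 - 0%:Z = q by lia.
  rewrite !addr0 => <-.
  under eq_bigr => i _ do rewrite add0r.
  apply: (sum_stable (a := fun i => binz K p i *: Y (Y u i%:Z v) (p + q - i%:Z) w)).
    by move=> i le; rewrite uv0 // (lin0 (Y_linl _ _)) scaler0.
  by rewrite /N; lia.
by rewrite binz_0 mulr0 scale0r.
Qed.

(** L(0) is the mode 1 of [om], so the commutator has only the terms i = 0 and i = 1; the first is a
    mode of L(-1)u, which the derivative axiom turns into -(k+1) u_k. *)
Lemma L0_comm u k w :
  L 0 (Y u k w) = Y (L 0 u) k w + Y u k (L 0 w) - (k + 1)%:~R *: Y u k w.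
Proof.
have [M hM] := Y_trunc om 0 u.
have h (i : nat) : (M.+2 <= i)%N -> Y om i%:Z u = 0.
  by move=> le; have := hM i; rewrite add0r => ->//; lia.
have := commutator 1 k w h; rewrite !big_ord_recl big1 => [|i _]; last first.
  by rewrite /binz !big_ord_recl /= /bump /= subrr mul0r mulr0 mul0r scale0r.
rewrite addr0 /binz !(big_ord_recl, big_ord0) /= subr0 !mulr1 fact0 factS fact0.
rewrite !divr1 !scale1r /bump /= => e.
have {}e : L 0 (Y u k w) - Y u k (L 0 w) = Y (L (-1) u) (k + 1) w + Y (L 0 u) k w.
  have e1 : 1 + k - ((1 + 0)%N)%:Z = k by lia.
  by rewrite e1 addr0 [1 + k]addrC in e.
move/eqP: e; rewrite Y_Lm1 addrK subr_eq => /eqP ->.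
by rewrite [LHS]addrC [- _ + _]addrC addrCA addrA.
Qed.

Lemma hom_Y a n u k w : hom a u -> hom n w -> hom (a + n - k - 1) (Y u k w).
Proof.
move=> hu hw; rewrite /homog L0_comm hu hw (linZ _ _ (Y_linr u k)).
rewrite (linZ _ _ (Y_linl k w)) -!scalerDl -scalerBl -!rmorphD -rmorphB /=.
by congr (_%:~R *: _); lia.
Qed.

Lemma hom_Lm1 a u : hom a u -> hom (a + 1) (L (-1) u).
Proof.
have om2 : hom 2 om by case: HV => _ [_ [_ [_ [_ [_ [_ [_ [_ [h _]]]]]]]]].
move=> hu; have := hom_Y (-1 + 1) om2 hu.
by rewrite (_ : 2 + a - (-1 + 1) - 1 = a + 1) //; lia.
Qed.

Lemma Y_proj_supp x (k : int -> int) w : fsuppz (fun j => Y (proj j x) (k j) w).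
Proof.
have [B h] := proj_supp x; exists B => j le.
by rewrite h // (lin0 (Y_linl _ _)).
Qed.

Lemma zmode_linl w : lin (fun x => zmode x w).
Proof.
move=> a x y; rewrite /Defs.zmode -zsum_lin; try exact: (Y_proj_supp _ (fun k => k - 1)).
by apply: eq_zsum => k; rewrite (proj_lin k) (Y_linl (k - 1) w).
Qed.

Lemma zmode_linr x : lin (zmode x).
Proof.
move=> a w w'; rewrite /Defs.zmode -zsum_lin; try exact: (Y_proj_supp _ (fun k => k - 1)).
by apply: eq_zsum => k; rewrite (Y_linr (proj k x) (k - 1)).
Qed.

Lemma zmode_hom x n : stable (hom n) (zmode x).
Proof.
move=> w hw; apply: hom_zsum; first exact: (Y_proj_supp _ (fun k => k - 1)).
move=> k; have := hom_Y (k - 1) (proj_hom k x) hw.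
by rewrite (_ : k + n - (k - 1) - 1 = n) //; lia.
Qed.

Lemma zmodeE a x w : hom a x -> zmode x w = Y x (a - 1) w.
Proof.
move=> hx; rewrite /Defs.zmode (zsum_single (k0 := a)) ?(proj_id _ hx) ?eqxx //.
by move=> k /negbTE ne; rewrite (proj_id _ hx) ne (lin0 (Y_linl _ _)).
Qed.

Lemma brk_h_supp k u m w :
  fsupp (fun i : nat => bcoef R k (m + i%:Z) i *: Y u (m + i%:Z) w).
Proof.
by have [M h] := Y_trunc u m w; exists M => i le; rewrite h // scaler0.
Qed.

Lemma brk_h_linl k m w : lin (fun u => brk_h k u m w).
Proof.
move=> a x y; rewrite /Defs.brk_h -nsum_lin; try exact: brk_h_supp.
apply: eq_nsum => i; rewrite (Y_linl (m + i%:Z) w).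
by rewrite scalerDr !scalerA mulrC.
Qed.

Lemma brk_h_linr k u m : lin (brk_h k u m).
Proof.
move=> a x y; rewrite /Defs.brk_h -nsum_lin; try exact: brk_h_supp.
apply: eq_nsum => i; rewrite (Y_linr u (m + i%:Z)).
by rewrite scalerDr !scalerA mulrC.
Qed.

Lemma brk_supp u m w : fsuppz (fun k => brk_h k (proj k u) m w).
Proof.
have [B h] := proj_supp u; exists B => j le.
by rewrite h // (lin0 (brk_h_linl _ _ _)).
Qed.

Lemma brk_linl m w : lin (fun u => brk u m w).
Proof.
move=> a x y; rewrite /Defs.brk -zsum_lin; try exact: brk_supp.
by apply: eq_zsum => k; rewrite (proj_lin k) (brk_h_linl k m w).
Qed.

Lemma brk_linr u m : lin (brk u m).
Proof.
move=> a x y; rewrite /Defs.brk -zsum_lin; try exact: brk_supp.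
by apply: eq_zsum => k; rewrite (brk_h_linr k (proj k u) m).
Qed.

Lemma brkE a u m w : hom a u -> brk u m w = brk_h a u m w.
Proof.
move=> hu; rewrite /Defs.brk (zsum_single (k0 := a)) ?(proj_id _ hu) ?eqxx //.
by move=> k /negbTE ne; rewrite (proj_id _ hu) ne (lin0 (brk_h_linl _ _ _)).
Qed.

Lemma brkE_sum a u m w M : hom a u ->
  (forall i, (M <= i)%N -> Y u (m + i%:Z) w = 0) ->
  brk u m w = \sum_(i < M) bcoef R a (m + i%:Z) i *: Y u (m + i%:Z) w.
Proof.
move=> hu h; rewrite (brkE _ _ hu) /Defs.brk_h (@nsumE _ _ M) // => i le.
by rewrite h ?scaler0.
Qed.

(** Reduces statements additive in u to the homogeneous components of u. *)
Lemma proj_ind (Q : V -> Prop) u : Q 0 -> (forall x y, Q x -> Q y -> Q (x + y)) ->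
  (forall k, Q (proj k u)) -> Q u.
Proof.
move=> Q0 QD hQ; rewrite (proj_sum u).
by have [B h] := proj_supp u; rewrite (zsumE h); elim/big_ind: _.
Qed.

Lemma brk_fsupp u w : fsupp (fun m : nat => brk u m%:Z w).
Proof.
apply: (proj_ind (Q := fun u => fsupp (fun m : nat => brk u m%:Z w))).
- by exists 0%N => i _; rewrite (lin0 (brk_linl _ _)).
- move=> x y [M h] [M' h']; exists (M + M')%N => i le.
  by rewrite (linD _ _ (brk_linl _ _)) h ?h' ?addr0 //; lia.
move=> k; have [M h] := Y_trunc (proj k u) 0 w; exists M => m le.
rewrite (brkE_sum (M := 0) (proj_hom k u)) ?big_ord0 // => i _.
by have := h (m + i)%N; rewrite add0r => -> //; lia.
Qed.

(* Change of basis from the modes [u_(i-s)] to the square bracket modes [u[m-s]]. *)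
Lemma brk_change a u w (s : int) (al ga : nat -> K) M : hom a u ->
  (forall i : nat, (M <= i)%N -> Y u (i%:Z - s) w = 0) ->
  (forall i, \sum_(m < i.+1) al m * bcoef R a (i%:Z - s) (i - m) = ga i) ->
  \sum_(m < M) al m *: brk u (m%:Z - s) w = \sum_(i < M) ga i *: Y u (i%:Z - s) w.
Proof.
move=> hu h hg.
pose F m i := (al m * bcoef R a (i%:Z - s) (i - m)) *: Y u (i%:Z - s) w.
transitivity (\sum_(m < M) \sum_(d < M - m) F m (m + d)%N).
  apply: eq_bigr => m _; have lt := ltn_ord m.
  rewrite (brkE_sum (M := (M - m)%N) hu) => [|i le]; last first.
    have := h (m + i)%N; rewrite PoszD -addrA [i%:Z + _]addrC addrA => -> //; lia.
  rewrite scaler_sumr; apply: eq_bigr => i _; rewrite /F scalerA addKn.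
  by rewrite (_ : m%:Z - s + i%:Z = (m + i)%:Z - s) //; lia.
rewrite sum_triangle; apply: eq_bigr => i _.
by rewrite -scaler_suml hg.
Qed.

(** Both sides are the residue of e^{kz} Y[u,z]w. The right side carries the coefficients of the
    commutator with u_{a-1+k}; the left side shows that they depend on k through the powers k^m. *)
Lemma brk_exp a u w (k : int) M : hom a u ->
  (forall i : nat, (M <= i)%N -> Y u i%:Z w = 0) ->
  \sum_(m < M) (k%:~R ^+ m / (m`!)%:R) *: brk u m%:Z w
  = \sum_(i < M) binz K (a + k - 1) i *: Y u i%:Z w.
Proof.
move=> hu h.
transitivity (\sum_(m < M) (k%:~R ^+ m / (m`!)%:R) *: brk u (m%:Z - 0) w).
  by apply: eq_bigr => m _; rewrite subr0.
transitivity (\sum_(i < M) binz K (a + k - 1) i *: Y u (i%:Z - 0) w).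
  apply: (@brk_change a u w 0 (fun m => k%:~R ^+ m / (m`!)%:R)) => // i.
    by rewrite subr0; apply: h.
  by rewrite subr0; exact: bcoef_exp_sum.
by apply: eq_bigr => m _; rewrite subr0.
Qed.

Lemma brk_bern a u w M : hom a u ->
  (forall i : nat, (M <= i)%N -> Y u (i%:Z - 1) w = 0) ->
  \sum_(m < M) (bern K m / (m`!)%:R + (m == 1%N :> nat)%:R) *: brk u (m%:Z - 1) w
  = \sum_(i < M) binz K a i *: Y u (i%:Z - 1) w.
Proof.
move=> hu h; apply: (@brk_change a u w 1
  (fun m => bern K m / (m`!)%:R + (m == 1%N :> nat)%:R)) => // i.
exact: bcoef_bern_sum.
Qed.

(** The operator L[-1], the translation operator for the square bracket modes. *)
Definition Lbrk (u : V) : V := L (-1) u + L 0 u.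

Lemma Lbrk_lin : lin Lbrk.
Proof.
move=> a x y; rewrite /Lbrk /Lop (Y_linr om (-1 + 1)) (Y_linr om (0 + 1)).
by rewrite scalerDr addrACA.
Qed.

(** For u of weight k the zero mode of L(-1)u is its mode k, that is -k u_{k-1}, and it cancels the
    contribution of L(0)u = k u. *)
Lemma zmode_Lbrk u w : zmode (Lbrk u) w = 0.
Proof.
apply: (proj_ind (Q := fun u => zmode (Lbrk u) w = 0)).
- by rewrite (lin0 Lbrk_lin) (lin0 (zmode_linl _)).
- by move=> x y hx hy; rewrite (linD _ _ Lbrk_lin) (linD _ _ (zmode_linl _)) hx hy addr0.
move=> k; set x := proj k u; have hx : hom k x := proj_hom k u.
rewrite (linD _ _ (zmode_linl w)) (zmodeE _ (hom_Lm1 hx)) hx addrK.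
by rewrite (linZ _ _ (zmode_linl w)) (zmodeE _ hx) Y_Lm1 addNr.
Qed.

Lemma brk_Lbrk u m w : brk (Lbrk u) m w = - (m%:~R *: brk u (m - 1) w).
Proof.
apply: (proj_ind (Q := fun u => brk (Lbrk u) m w = - (m%:~R *: brk u (m - 1) w))).
- by rewrite (lin0 Lbrk_lin) !(lin0 (brk_linl _ _)) scaler0 oppr0.
- move=> x y hx hy; rewrite (linD _ _ Lbrk_lin) (linD _ _ (brk_linl m w)) hx hy.
  rewrite (linD x y (brk_linl (m - 1) w)).
  by rewrite scalerDr opprD.
move=> k; set x := proj k u; have hx : hom k x := proj_hom k u.
rewrite (linD _ _ (brk_linl m w)) hx (linZ _ _ (brk_linl m w)).
have [M h] := Y_trunc x (m - 1) w.
have h1 i : (M.+1 <= i)%N -> Y x (m - 1 + i%:Z) w = 0.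
  by move=> le; apply: h; exact: ltnW.
have h2 (i : nat) : (M <= i)%N -> Y x (m + i%:Z) w = 0.
  move=> le; have := h i.+1; rewrite (_ : m - 1 + i.+1%:Z = m + i%:Z); last by lia.
  by apply; lia.
have h3 (i : nat) : (M.+1 <= i)%N -> Y (L (-1) x) (m + i%:Z) w = 0.
  move=> le; rewrite Y_Lm1 (_ : m + i%:Z - 1 = m - 1 + i%:Z); last by lia.
  by rewrite h1 // scaler0 oppr0.
rewrite (brkE_sum (hom_Lm1 hx) h3) (brkE_sum hx h2) (brkE_sum hx h1).
rewrite !scaler_sumr big_ord_recl [in RHS]big_ord_recl /= opprD -addrA.
(* The leading terms agree because [bcoef] at depth 0 is 1. After them, term i+1 of L(-1)x and term
   i of L(0)x are multiples of the same mode x_{m+i}, and [bcoef_deriv] adds their coefficients. *)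
congr (_ + _).
  by rewrite !bcoef0 !scale1r Y_Lm1 !addr0.
rewrite -big_split -sumrN /=; apply: eq_bigr => i _; rewrite /bump /= add1n.
rewrite Y_Lm1 (_ : m + i.+1%:Z - 1 = m + i%:Z); last by lia.
rewrite (_ : m - 1 + i.+1%:Z = m + i%:Z); last by lia.
have -> : m + i.+1%:Z = m + i%:Z + 1 by lia.
rewrite !scalerN -!scaleNr !scalerA -!scalerDl; congr (_ *: _).
by rewrite [RHS]mulNr -bcoef_deriv; ring.
Qed.

End VOA.

(** * Divisor sums *)

Section TwistedEisenstein.
Variable K : numFieldType.

(** The divisor sum created by the iteration: one factor e for each of the i/d turns around the
    trace. *)
Definition Dsum (e : K) (m i : nat) : K :=
  \sum_(d <- divisors i) e ^+ (i %/ d) * d%:R ^+ m.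

(** E_k for e = 1 and F_k for e = -1. The constant term is the same for both, since 2E_k(2 tau) -
    E_k(tau) and E_k have equal constant terms. *)
Definition Gc (e : K) (k i : nat) : K :=
  if odd k then 0
  else if i == 0%N then - bern K k / (k`!)%:R
  else 2%:R / ((k.-1)`!)%:R * Dsum e k.-1 i.

Lemma Dsum1 m i : Dsum 1 m i = sigmaK K m i.
Proof.
rewrite /Dsum /sigmaK natr_sum; apply: eq_bigr => d _.
by rewrite expr1n mul1r natrX.
Qed.

(** Adding the two sums for e = -1 and e = 1 leaves twice the divisors d with i/d even; these are
    the divisors of i/2, and there are none when i is odd. *)
Lemma DsumN1 m i : (0 < i)%N ->
  Dsum (-1) m i = 2%:R * (if odd i then 0 else sigmaK K m i./2) - sigmaK K m i.
Proof.
move=> i0; rewrite -!Dsum1.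
suff <- : Dsum (-1) m i + Dsum 1 m i = 2%:R * (if odd i then 0 else Dsum 1 m i./2).
  by rewrite addrK.
rewrite /Dsum -big_split /=.
transitivity (\sum_(d <- divisors i | ~~ odd (i %/ d)) 2%:R * (1 * d%:R ^+ m : K)).
  rewrite [RHS]big_mkcond; apply: eq_bigr => d _; rewrite expr1n -signr_odd.
  by case: (odd _); rewrite /= ?expr0 ?expr1; ring.
rewrite -mulr_sumr; congr (_ * _); case: (boolP (odd i)) => oi.
  rewrite big_seq_cond big1 // => d /andP[]; rewrite -dvdn_divisors // => /divnK e.
  by move: oi; rewrite -{1}e oddM => /andP[->].
rewrite [RHS](eq_bigr (fun d => 1 * d%:R ^+ m)) => [|d _]; last by rewrite expr1n.
rewrite -[LHS]big_filter; apply: perm_big.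
have ei : i = (i./2 * 2)%N by rewrite muln2 -[LHS]odd_double_half (negbTE oi).
have h0 : (0 < i./2)%N by move: i0; rewrite {1}ei; case: (i./2).
apply: uniq_perm; rewrite ?filter_uniq ?divisors_uniq // => d.
rewrite mem_filter -!dvdn_divisors //; apply/andP/idP => [[ev /dvdnP[q eq]]|].
  have d0 : (0 < d)%N by move: i0; rewrite eq muln_gt0 => /andP[].
  rewrite eq mulnK // in ev; rewrite eq -(even_halfK ev) -muln2 mulnAC.
  by rewrite muln2 doubleK dvdn_mull.
move=> /dvdnP[q eq]; have d0 : (0 < d)%N by move: h0; rewrite eq muln_gt0 => /andP[].
by rewrite ei eq mulnAC mulnK // oddM andbF dvdn_mull.
Qed.

Lemma Gc1 k : Gc 1 k = Ec K k.
Proof. by apply: funext => i; rewrite /Gc /Ec Dsum1. Qed.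

Lemma GcN1 k : Gc (-1) k = Fc K k.
Proof.
apply: funext => i; rewrite /Gc /Fc /Ec; case: (odd k); first by rewrite if_same mulr0 subr0.
case: i => [|i] /=; first by rewrite mulr_natl mulr2n addrK.
rewrite DsumN1 //=; case: ifP => oi; first by rewrite mulr0 !sub0r mulrN.
rewrite (_ : (uphalf i == 0)%N = false) ?[uphalf i]/((i.+1)./2); first by ring.
by move: oi; case: i.
Qed.

(** Pairs (l, r) are regrouped by their product i, with l the divisor and r = i/l; products beyond M
    contribute nothing because h vanishes there. *)
Lemma sum_divisors (e : K) m M (h : nat -> K) : (forall i, (M <= i)%N -> h i = 0) ->
  \sum_(l < M) \sum_(r < M) e ^+ r.+1 * l.+1%:R ^+ m * h (l.+1 * r.+1)%N
  = \sum_(i < M) Dsum e m i.+1 * h i.+1.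
Proof.
move=> h0.
pose G l i := if (l %| i)%N then e ^+ (i %/ l) * l%:R ^+ m * h i else 0.
transitivity (\sum_(1 <= l < M.+1) \sum_(1 <= i < M.+1) G l i).
  rewrite big_add1 big_mkord; apply: eq_bigr => l _.
  have e1 r : e ^+ r.+1 * l.+1%:R ^+ m * h (l.+1 * r.+1)%N =
      \sum_(1 <= i < M.+1 | (i == l.+1 * r.+1)%N) G l.+1 i.
    rewrite big_nat1_eq ltnS muln_gt0 /=; case: ifP => [_|/negbT].
      by rewrite /G dvdn_mulr // mulKn.
    by rewrite -ltnNge => lt; rewrite h0 ?mulr0 // ltnW.
  under eq_bigr => r _ do rewrite e1 big_mkcond.
  rewrite exchange_big /=; apply: eq_big_nat => i /andP[i1 iM].
  rewrite -(big_mkcond (fun r : 'I_M => i == l.+1 * r.+1)%N) /=.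
  have [/dvdnP[q eq]|nd] := boolP (l.+1 %| i)%N; last first.
    by rewrite /G (negbTE nd) big1.
  have q0 : (0 < q)%N by move: i1; rewrite eq; case: (q).
  have qM : (q.-1 < M)%N.
    by rewrite prednK //; move: iM; rewrite eq ltnS; apply: leq_trans; rewrite leq_pmulr.
  rewrite (big_pred1 (Ordinal qM)) // => r; rewrite eq mulnC eqn_pmul2l //.
  rewrite /=; apply/eqP/eqP => [e2|->]; last by rewrite /= prednK.
  by apply: val_inj; rewrite /= e2.
rewrite exchange_big /= big_add1 big_mkord; apply: eq_bigr => i _.
rewrite /Dsum mulr_suml -big_mkcond /= -big_filter; apply: perm_big.
apply: uniq_perm; rewrite ?filter_uniq ?iota_uniq ?divisors_uniq // => d.
rewrite mem_filter mem_index_iota -dvdn_divisors //.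
case: (boolP (d %| _)%N) => //= dv; rewrite (dvdn_gt0 _ dv) //= ltnS.
exact: leq_trans (dvdn_leq _ dv) _.
Qed.

Lemma gco1_Gc e m i :
  gco K 1 m * Gc e m.+1 i.+1 = (1 - (-1) ^+ m) / (m`!)%:R * Dsum e m i.+1.
Proof.
rewrite /gco /Gc /= add1n subSS subn0 binn mulr1 exprS mulN1r.
rewrite -[(-1) ^+ m]signr_odd; case: (odd m) => /=; last by rewrite expr0 subrr !mul0r mulr0.
by rewrite expr1 opprK mul1r -[1 + 1]/(2%:R).
Qed.

End TwistedEisenstein.

(** For m > 0 this is minus the kernel coefficient, by the vanishing of odd Bernoulli numbers when m
    is even. At m = 0 the weight-one series is 0 but the kernel coefficient is B_1 + 1 = 1/2, whence
    the correction. *)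
Lemma gco1_Gc0 (R : realType) (e : R[i]) m :
  gco R[i] 1 m * Gc e m.+1 0 =
  (m == 0%N)%:R / 2%:R - (bern R[i] m.+1 / (m.+1`!)%:R + (m.+1 == 1%N)%:R).
Proof.
rewrite /gco /Gc /= add1n subSS subn0 binn mulr1 eqSS exprS mulN1r.
case: m => [|m].
  rewrite /= mulr0 /bern /= big_ord1 bin0 factS fact0 muln1 divr1.
  by field.
rewrite /= mul0r addr0 sub0r -[(-1) ^+ m.+1]signr_odd /=; case: (boolP (odd m)) => /= om.
  by rewrite bern_odd //= ?om // mul0r oppr0 mulr0.
by rewrite expr1 opprK mul1r mulNr.
Qed.

(** * Twisted traces of products of modes *)

Section TwistedTrace.
Variables (R : realType) (V : lmodType R[i]).
Local Notation K := (R[i]).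
Variables (Y : V -> int -> V -> V) (vac om : V) (c : K) (proj : int -> V -> V).
Hypothesis HV : is_VOA Y vac om c proj.
Local Notation hom := (homog Y om).
Local Notation L := (Lop Y om).
Local Notation brk := (brk Y proj).
Local Notation zmode := (zmode Y proj).
Variable s : V -> V.
Hypothesis Hs : is_inv_auto Y vac om s.

Lemma s_lin : lin s. Proof. by case: Hs => h _ _ _ _ a x y; exact: h. Qed.

Lemma s_Y u k w : s (Y u k w) = Y (s u) k (s w).
Proof. by case: Hs => _ h _ _ _; exact: h. Qed.

Lemma s_L k w : s (L k w) = L k (s w).
Proof. by rewrite /Lop s_Y; case: Hs => _ _ _ -> _. Qed.

Lemma s_hom n : stable (hom n) s.
Proof. by move=> w hw; rewrite /homog -s_L hw (linZ _ _ s_lin). Qed.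

Lemma s_proj k x : s (proj k x) = proj k (s x).
Proof.
have sx : s x = zsum (fun j => s (proj j x)).
  by rewrite [in LHS](proj_sum HV x) (lin_zsum s_lin (proj_supp HV x)).
have [B hB] := proj_supp HV x.
have fs : fsuppz (fun j => s (proj j x)).
  by exists B => j le; rewrite hB // (lin0 s_lin).
rewrite [in RHS]sx (lin_zsum (proj_lin HV k) fs) (zsum_single (k0 := k)).
  by rewrite (proj_id HV _ (s_hom (proj_hom HV k x))) eqxx.
move=> j /negbTE ne.
by rewrite (proj_id HV _ (s_hom (proj_hom HV j x))) eq_sym ne.
Qed.

Definition twtr (N : int) (f : V -> V) : K := ptrace (hom N) (fun w => s (f w)).
Definition Zs (x : V) (N : int) : K := twtr N (zmode x).

Lemma twtr_ext N f g : (forall w, hom N w -> f w = g w) -> twtr N f = twtr N g.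
Proof.
by move=> e; apply: ptrace_ext => [|w hw]; [exact: hom_findim HV N|rewrite e].
Qed.

Lemma s_stable N f : stable (hom N) f -> stable (hom N) (fun w => s (f w)).
Proof. by move=> h w hw; apply/s_hom/h. Qed.

Lemma twtr_lin N f g (a : K) : stable (hom N) f -> stable (hom N) g ->
  twtr N (fun w => a *: f w + g w) = a * twtr N f + twtr N g.
Proof.
move=> hf hg; rewrite /twtr -(ptrace_lin _ (hom_findim HV N)) //; try exact: s_stable.
by apply: ptrace_ext => [|w _]; [exact: hom_findim HV N|rewrite s_lin].
Qed.

Lemma twtrD N f g : stable (hom N) f -> stable (hom N) g ->
  twtr N (fun w => f w + g w) = twtr N f + twtr N g.
Proof.
move=> hf hg; rewrite -[twtr N f]mul1r -twtr_lin //.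
by apply: twtr_ext => w _; rewrite scale1r.
Qed.

Lemma twtr0 N : twtr N (fun _ => 0) = 0.
Proof.
rewrite -[RHS](ptrace0 (hom_findim HV N)); apply: ptrace_ext => [|w _].
  exact: hom_findim HV N.
exact: lin0 s_lin.
Qed.

Lemma twtr_low (n0 : int) N f : (forall n v, n < n0 -> hom n v -> v = 0) -> N < n0 ->
  lin f -> twtr N f = 0.
Proof.
move=> h0 lt lf; rewrite -(twtr0 N); apply: twtr_ext => w /(h0 _ _ lt) ->.
exact: lin0 lf.
Qed.

Lemma twtr_sum N I (r : seq I) (F : I -> V -> V) : (forall i, stable (hom N) (F i)) ->
  twtr N (fun w => \sum_(i <- r) F i w) = \sum_(i <- r) twtr N (F i).
Proof.
move=> hF; elim: r => [|i r IH].
  by rewrite big_nil -(twtr0 N); apply: twtr_ext => w _; rewrite big_nil.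
rewrite big_cons -IH -twtrD //.
  by apply: twtr_ext => w _; rewrite big_cons.
move=> w hw; elim/big_ind: _ => [|x y hx hy|j _]; first exact: hom0 HV N.
  exact: (homD HV).
exact: hF.
Qed.

Lemma Zs_lin N x y a : Zs (a *: x + y) N = a * Zs x N + Zs y N.
Proof.
rewrite /Zs -twtr_lin; try exact: (zmode_hom HV).
by apply: twtr_ext => w _; rewrite (zmode_linl HV w).
Qed.

Lemma Zs0 N : Zs 0 N = 0.
Proof.
by have := Zs_lin N 0 0 (-1); rewrite scaler0 addr0 mulN1r addNr.
Qed.

Lemma ZsZ N a x : Zs (a *: x) N = a * Zs x N.
Proof. by rewrite -[a *: x]addr0 Zs_lin Zs0 addr0. Qed.

Lemma ZsD N x y : Zs (x + y) N = Zs x N + Zs y N.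
Proof. by rewrite -[x in LHS]scale1r Zs_lin mul1r. Qed.

Lemma Zs_sum N I (r : seq I) (a : I -> K) (x : I -> V) :
  Zs (\sum_(i <- r) a i *: x i) N = \sum_(i <- r) a i * Zs (x i) N.
Proof.
elim: r => [|i r IH]; first by rewrite !big_nil Zs0.
by rewrite !big_cons Zs_lin IH.
Qed.

Variable e : K.
Hypothesis ee : e * e = 1.

Section Homogeneous.
Variables (u v : V) (a b : int).
Hypotheses (hu : hom a u) (hv : hom b v) (su : s u = e *: u).

Definition trUV (k N : int) := twtr N (fun w => Y u (a - 1 + k) (Y v (b - 1 - k) w)).
Definition trVU (k N : int) := twtr N (fun w => Y v (b - 1 - k) (Y u (a - 1 + k) w)).

Lemma U_hom k n w : hom n w -> hom (n - k) (Y u (a - 1 + k) w).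
Proof.
move=> hw; have := hom_Y HV (a - 1 + k) hu hw.
by rewrite (_ : a + n - _ - 1 = n - k) //; lia.
Qed.

Lemma V_hom k n w : hom n w -> hom (n + k) (Y v (b - 1 - k) w).
Proof.
move=> hw; have := hom_Y HV (b - 1 - k) hv hw.
by rewrite (_ : b + n - _ - 1 = n + k) //; lia.
Qed.

Lemma UV_hom k N : stable (hom N) (fun w => Y u (a - 1 + k) (Y v (b - 1 - k) w)).
Proof. by move=> w hw; have := U_hom k (V_hom k hw); rewrite addrK. Qed.

Lemma VU_hom k N : stable (hom N) (fun w => Y v (b - 1 - k) (Y u (a - 1 + k) w)).
Proof. by move=> w hw; have := V_hom k (U_hom k hw); rewrite subrK. Qed.

Lemma Y_s k w : Y u k (s w) = e *: s (Y u k w).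
Proof. by rewrite s_Y su (linZ _ _ (Y_linl HV k (s w))) scalerA ee scale1r. Qed.

(** u_{a-1+k} maps V_N to V_{N-k}, so moving it around the trace changes the weight space; passing
    it through s costs the factor e, which is its own inverse. *)
Lemma trVU_cyclic k N : trVU k N = e * trUV k (N - k).
Proof.
rewrite /trVU /trUV /twtr.
rewrite (@ptrace_cyclic _ _ (hom N) (hom (N - k)) (Y u (a - 1 + k))
  (fun w => s (Y v (b - 1 - k) w))); try exact: hom_findim HV _.
- have f0 := hom_findim HV (N - k).
  have st : stable (hom (N - k)) (fun w => s (Y u (a - 1 + k) (Y v (b - 1 - k) w))).
    exact/s_stable/UV_hom.
  have s0 : stable (hom (N - k)) (fun _ => 0) by move=> w _; exact: hom0 HV _.
  have := ptrace_lin e f0 st s0; rewrite (ptrace0 f0) addr0 => <-.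
  by apply: ptrace_ext => // w _; rewrite Y_s addr0.
- exact: (Y_linr HV).
- by move=> x y z; rewrite (Y_linr HV v (b - 1 - k)) s_lin.
- by move=> w; exact: U_hom.
- by move=> w hw; apply: s_hom; have := V_hom k hw; rewrite subrK.
Qed.

Variable n0 : int.
Hypothesis hlow : forall n v, n < n0 -> hom n v -> v = 0.

Lemma Ylin2 x y k l : lin (fun w => Y x k (Y y l w)).
Proof. by move=> d w w'; rewrite (Y_linr HV y l) (Y_linr HV x k). Qed.

Lemma trUV_low k N : N < n0 -> trUV k N = 0.
Proof. by move=> lt; apply: twtr_low hlow lt _; exact: Ylin2. Qed.

Lemma trVU_low k N : N < n0 -> trVU k N = 0.
Proof. by move=> lt; apply: twtr_low hlow lt _; exact: Ylin2. Qed.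

Lemma Zs_low x N : N < n0 -> Zs x N = 0.
Proof. by move=> lt; apply: twtr_low hlow lt _; exact: zmode_linr HV x. Qed.

Variable M : nat.
Hypothesis hM : forall i : nat, (M <= i)%N -> Y u i%:Z v = 0.

Definition commtr (k N : int) : K :=
  \sum_(m < M) (k%:~R ^+ m / (m`!)%:R) * Zs (brk u m%:Z v) N.

Lemma trUV_comm k N : trUV k N = commtr k N + trVU k N.
Proof.
have pw w : Y u (a - 1 + k) (Y v (b - 1 - k) w) =
  zmode (\sum_(m < M) (k%:~R ^+ m / (m`!)%:R) *: brk u m%:Z v) w
  + Y v (b - 1 - k) (Y u (a - 1 + k) w).
  apply/eqP; rewrite -subr_eq; apply/eqP.
  rewrite (commutator HV _ _ _ hM) (brk_exp HV _ hu hM).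
  rewrite (lin_sum _ _ _ (zmode_linl HV w)); apply: eq_bigr => i _.
  rewrite (linZ _ _ (zmode_linl HV w)) (zmodeE HV _ (hom_Y HV _ hu hv)).
  have -> : a - 1 + k = a + k - 1 by lia.
  by congr (_ *: Y _ _ w); lia.
rewrite /trUV (twtr_ext (fun w _ => pw w)) twtrD -/(trVU k N).
- by rewrite -/(Zs _ N) Zs_sum.
- exact: zmode_hom HV _ _.
- exact: VU_hom.
Qed.

Lemma trVU_iter l N S : trVU l N =
  \sum_(r < S) e ^+ r.+1 * commtr l (N - l * r.+1%:Z) + e ^+ S * trVU l (N - l * S%:Z).
Proof.
elim: S => [|S IH]; first by rewrite big_ord0 add0r mul1r mulr0 subr0.
rewrite IH big_ord_recr /= -addrA; congr (_ + _).
rewrite trVU_cyclic trUV_comm exprSr mulrA -mulrDr.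
by rewrite (_ : N - l * S - l = N - l * S.+1%:Z) //; lia.
Qed.

(** At index -l cyclicity is read backwards: X_{-l}(N) = e X'_{-l}(N - l), so for l > 0 the weight
    again decreases, and the commutator enters with a minus sign. *)
Lemma trUV_iter l N S : trUV (- l) N =
  - (\sum_(r < S) e ^+ r.+1 * commtr (- l) (N - l * r.+1%:Z))
  + e ^+ S * trUV (- l) (N - l * S%:Z).
Proof.
elim: S => [|S IH]; first by rewrite big_ord0 oppr0 add0r mul1r mulr0 subr0.
rewrite IH big_ord_recr /= opprD -addrA; congr (_ + _).
have := trVU_cyclic (- l) (N - l * S.+1%:Z).
rewrite (_ : N - l * S.+1%:Z - - l = N - l * S%:Z); last by lia.
move=> h; rewrite [in RHS]trUV_comm h exprSr.
rewrite mulrDr addKr -[in RHS]mulrA [e * (e * _)]mulrA ee mul1r //.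
Qed.

(** The Borcherds identity at p = a, q = b - 1, r = -1. The binomials of -1 cancel the signs, so
    every term on the right has coefficient 1. The bound on N makes the modes with index beyond B
    kill V_N. *)
Lemma kernel_trace N (B : nat) : (M < B)%N -> N - B%:Z < n0 ->
  \sum_(m < B) (bern K m / (m`!)%:R + (m == 1%N :> nat)%:R)
     * Zs (brk u (m%:Z - 1) v) N
  = \sum_(i < B) (trUV (- i%:Z) N + trVU (1 + i%:Z) N).
Proof.
move=> MB NB; rewrite -Zs_sum.
have h1 (i : nat) : (B <= i)%N -> Y u (i%:Z - 1) v = 0.
  case: i => [|i] le; first by lia.
  by rewrite (_ : i.+1%:Z - 1 = i%:Z) ?hM //; lia.
transitivity (twtr N (fun w => \sum_(i < B) (
    Y u (a - 1 + - i%:Z) (Y v (b - 1 - - i%:Z) w)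
  + Y v (b - 1 - (1 + i%:Z)) (Y u (a - 1 + (1 + i%:Z)) w)))).
  apply: twtr_ext => w hw; rewrite (brk_bern HV hu h1).
  rewrite (lin_sum _ _ _ (zmode_linl HV w)).
  have bd (i : nat) : (B <= i)%N ->
      [/\ Y u (-1 + i%:Z) v = 0, Y v (b - 1 + i%:Z) w = 0 & Y u (a + i%:Z) w = 0].
    move=> le; split.
    - by rewrite addrC h1.
    - have := V_hom (- i%:Z) hw; rewrite opprK; apply: hlow; lia.
    have := U_hom (1 + i%:Z) hw; rewrite (_ : a - 1 + (1 + i%:Z) = a + i%:Z).
      by apply: hlow; lia.
    by lia.
  have := borcherds HV bd.
  rewrite (eq_bigr (fun i : 'I_B => zmode (binz K a i *: Y u (i%:Z - 1) v) w)).
    move=> ->; apply: eq_bigr => i _.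
    rewrite binz_m1 -exprMn mulN1r opprK expr1n scale1r.
    rewrite exprN1 invrN1 scaleN1r opprK.
    congr (Y _ _ (Y _ _ _) + Y _ _ (Y _ _ _)); lia.
  move=> i _; rewrite (linZ _ _ (zmode_linl HV w)).
  rewrite (zmodeE HV _ (hom_Y HV _ hu hv)); congr (_ *: Y (Y _ _ _) _ _); lia.
rewrite twtr_sum => [|i w hw]; last first.
  by apply: (homD HV); [exact: UV_hom|exact: VU_hom].
by apply: eq_bigr => i _; apply: twtrD; [exact: UV_hom|exact: VU_hom].
Qed.

End Homogeneous.
End TwistedTrace.

(** * The twisted recursion *)

Section Recursion.
Variables (R : realType) (V : lmodType R[i]).
Local Notation K := (R[i]).
Variables (Y : V -> int -> V -> V) (vac om : V) (c : K) (proj : int -> V -> V).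
Hypothesis HV : is_VOA Y vac om c proj.
Local Notation hom := (homog Y om).
Local Notation brk := (brk Y proj).
Local Notation zmode := (zmode Y proj).
Variable s : V -> V.
Hypothesis Hs : is_inv_auto Y vac om s.
Variable e : K.
Hypothesis ee : e * e = 1.
Local Notation Zs := (Zs Y om proj s).
Local Notation twtr := (twtr Y om s).

Lemma commtr0 u v M N : commtr Y om proj s u v M.+1 0 N = Zs (brk u 0 v) N.
Proof.
rewrite /commtr big_ord_recl big1 ?addr0 => [|i _]; last first.
  by rewrite /= mulr0z expr0n mul0r mul0r.
by rewrite expr0 fact0 divr1 mul1r.
Qed.

Section Homogeneous.
Variables (u v : V) (a b : int).
Hypotheses (hu : hom a u) (hv : hom b v) (su : s u = e *: u).
Variable n0 : int.
Hypothesis hlow : forall n v, n < n0 -> hom n v -> v = 0.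
Variable M : nat.
Hypothesis hM : forall i : nat, (M.+1 <= i)%N -> Y u i%:Z v = 0.
Variable N : int.
Hypothesis hN : N - M.+1%:Z < n0.

Local Notation trUV := (trUV Y om s u v a b).
Local Notation trVU := (trVU Y om s u v a b).
Local Notation ctr := (commtr Y om proj s u v M.+1).

Lemma trUV0 N' : trUV 0 N' = twtr N' (fun w => zmode u (zmode v w)).
Proof.
apply: (twtr_ext HV) => w _.
by rewrite (zmodeE HV _ hu) (zmodeE HV _ hv) addr0 subr0.
Qed.

Lemma Zs_brk0_hom N' : Zs (brk u 0 v) N' = (1 - e) * trUV 0 N'.
Proof.
have := trUV_comm HV Hs hu hv hM 0 N'.
rewrite commtr0 (trVU_cyclic HV Hs ee hu hv su) subr0 => h.
by rewrite mulrBl mul1r {1}h addrK.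
Qed.

(** The commutator traces are polynomial in l, so only odd powers survive in the difference. *)
Lemma ctr_diff (l : nat) N' : ctr l%:Z N' - ctr (- l%:Z) N' =
  \sum_(m < M.+1) (1 - (-1) ^+ m) / (m`!)%:R * (l%:R ^+ m * Zs (brk u m%:Z v) N').
Proof.
rewrite /commtr -sumrB; apply: eq_bigr => m _.
have -> : (- l%:Z)%:~R ^+ m = (-1) ^+ m * l%:R ^+ m :> K.
  by rewrite rmorphN [LHS]exprNn.
by rewrite -[l%:Z%:~R]/(l%:R); ring.
Qed.

Lemma trace_pairs (l : nat) : trUV (- l.+1%:Z) N + trVU l.+1%:Z N =
  \sum_(m < M.+1) (1 - (-1) ^+ m) / (m`!)%:R *
    \sum_(r < M.+1) e ^+ r.+1 * l.+1%:R ^+ m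
      * Zs (brk u m%:Z v) (N - (l.+1 * r.+1)%N%:Z).
Proof.
(* After M+1 turns, each lowering the weight by l+1 >= 1, both remainders of the iteration
   vanish. *)
have low : N - l.+1%:Z * M.+1%:Z < n0 by nia.
rewrite (trUV_iter HV Hs ee hu hv su hM l.+1 N M.+1).
rewrite (trVU_iter HV Hs ee hu hv su hM l.+1 N M.+1).
rewrite (trUV_low HV Hs _ _ _ _ hlow) // (trVU_low HV Hs _ _ _ _ hlow) //.
rewrite !mulr0 !addr0 addrC -sumrB.
under [RHS]eq_bigr => m _ do rewrite mulr_sumr.
rewrite exchange_big /=; apply: eq_bigr => r _.
rewrite -mulrBr ctr_diff mulr_sumr; apply: eq_bigr => m _.
by rewrite PoszM; ring.
Qed.

Lemma recursion1_hom : Zs (brk u (-1) v) N =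
  (1 + e) / 2%:R * twtr N (fun w => zmode u (zmode v w))
  + \sum_(m < M.+1) gco K 1 m *
      \sum_(i < M.+2) Gc e m.+1 i * Zs (brk u m%:Z v) (N - i%:Z).
Proof.
pose z (m : nat) N' := Zs (brk u m%:Z v) N'.
pose be (m : nat) : K := bern K m.+1 / (m.+1`!)%:R + (m.+1 == 1%N)%:R.
pose W := \sum_(m < M.+1) (1 - (-1) ^+ m) / (m`!)%:R *
  \sum_(i < M.+1) Dsum e m i.+1 * z m (N - i.+1%:Z).
have eW : \sum_(l < M.+1) (trUV (- l.+1%:Z) N + trVU l.+1%:Z N) = W.
  under eq_bigr => l _ do rewrite trace_pairs.
  rewrite exchange_big; apply: eq_bigr => m _ /=; rewrite -mulr_sumr; congr (_ * _).
  rewrite -(@sum_divisors _ e m M.+1 (fun j => z m (N - j%:Z))) // => i le.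
  by apply: (Zs_low HV Hs hlow); lia.
have h := kernel_trace HV Hs hu hv hlow hM (ltnSn M.+1) (N := N).
have {}h : Zs (brk u (-1) v) N + \sum_(m < M.+1) be m * z m N = trUV 0 N + W.
  rewrite -eW; move: h; rewrite big_ord_recl /= => h.
  rewrite fact0 divr1 /bern /= addr0 mul1r in h.
  have -> : \sum_(m < M.+1) be m * z m N = \sum_(i < M.+1)
     (bern K (bump 0 i) / ((bump 0 i)`!)%:R + (bump 0 i == 1%N)%:R)
     * Zs (brk u ((bump 0 i)%:Z - 1) v) N.
    by apply: eq_bigr => i _; rewrite /bump /= add1n /z; congr (_ * Zs (brk u _ v) N); lia.
  rewrite h; last by lia.
  (* X_{-i} is paired with X'_i: the unpaired X_0 is split off in front, and the unpaired last X' is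
     zero because cyclicity moves it below n0. *)
  rewrite big_split big_ord_recl /= oppr0 [X in _ + X]big_ord_recr /=.
  rewrite (trVU_cyclic HV Hs ee hu hv su) [trUV _ (_ - _)](trUV_low HV Hs _ _ _ _ hlow);
    last by lia.
  rewrite mulr0 addr0 -addrA -big_split; congr (_ + _); exact: eq_bigr.
have -> : \sum_(m < M.+1) gco K 1 m * \sum_(i < M.+2) Gc e m.+1 i * z m (N - i%:Z)
   = 2%:R^-1 * z 0%N N - \sum_(m < M.+1) be m * z m N + W.
  rewrite (_ : 2%:R^-1 * z 0%N N = \sum_(m < M.+1) (m == 0%N :> nat)%:R / 2%:R * z m N).
    rewrite -sumrB -big_split; apply: eq_bigr => m _ /=.
    rewrite big_ord_recl subr0 mulrDr mulrA gco1_Gc0 -/(be m) mulrBl; congr (_ + _).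
    by rewrite !mulr_sumr; apply: eq_bigr => i _; rewrite !mulrA /bump /= gco1_Gc.
  rewrite big_ord_recl big1 ?addr0 => [|i _]; last by rewrite /= mul0r mul0r.
  by rewrite mul1r.
(* Replacing the trace of u[0]v by (1 - e) X_0 turns X_0 minus half of that trace into (1 + e)/2
   X_0. *)
rewrite /z Zs_brk0_hom trUV0 in h *.
move/eqP: h; rewrite -subr_eq0 => /eqP h; apply/eqP; rewrite -subr_eq0; apply/eqP.
by rewrite -[RHS]h; field.
Qed.

End Homogeneous.

Lemma qmul_Zs N : exists D, forall f x,
  qmul f (Zs x) N = \sum_(i < D) f i * Zs x (N - i%:Z).
Proof.
have [n0 hlow] := hom_low HV; exists (absz (N - n0)).+1 => f x.
apply: nsumE => i le; rewrite (Zs_low HV Hs hlow) ?mulr0 //; lia.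
Qed.

Lemma qmul_ZsD f x y N : qmul f (Zs (x + y)) N = qmul f (Zs x) N + qmul f (Zs y) N.
Proof.
have [D q] := qmul_Zs N; rewrite !q -big_split; apply: eq_bigr => i _ /=.
by rewrite (ZsD HV Hs) mulrDr.
Qed.

Lemma qmul_ZsZ f k x N : qmul f (Zs (k *: x)) N = k * qmul f (Zs x) N.
Proof.
have [D q] := qmul_Zs N; rewrite !q mulr_sumr; apply: eq_bigr => i _ /=.
by rewrite (ZsZ HV Hs) mulrCA.
Qed.

Lemma qmul_Zs0 f N : qmul f (Zs 0) N = 0.
Proof. by rewrite -(scale0r (0 : V)) qmul_ZsZ mul0r. Qed.

Lemma fsupp_rec (g : nat -> K) (f : nat -> nat -> K) u v N :
  fsupp (fun m => g m * qmul (f m) (Zs (brk u m%:Z v)) N).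
Proof.
have [M h] := brk_fsupp HV u v; exists M => m le.
by rewrite h // qmul_Zs0 mulr0.
Qed.

Definition recursion n u v N := Zs (brk u (- n%:Z) v) N =
  (n == 1%N)%:R * ((1 + e) / 2%:R * twtr N (fun w => zmode u (zmode v w)))
  + nsum (fun m => gco K n m * qmul (Gc e (n + m)) (Zs (brk u m%:Z v)) N).

Lemma zmode2_stable u v N : stable (hom N) (fun w => zmode u (zmode v w)).
Proof. by move=> w hw; apply/(zmode_hom HV)/(zmode_hom HV). Qed.

Lemma recursionDl n u1 u2 v N :
  recursion n u1 v N -> recursion n u2 v N -> recursion n (u1 + u2) v N.
Proof.
rewrite /recursion => h1 h2.
have bD m : brk (u1 + u2) m v = brk u1 m v + brk u2 m v.
  exact: (linD _ _ (brk_linl HV m v)).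
rewrite bD (ZsD HV Hs) h1 h2 addrACA -!mulrDr -(twtrD HV Hs); try exact: zmode2_stable.
congr (_ * (_ * _) + _).
  by apply: (twtr_ext HV) => w _; rewrite (linD _ _ (zmode_linl HV (zmode v w))).
rewrite -nsumD; try exact: fsupp_rec.
by apply: eq_nsum => m; rewrite bD qmul_ZsD mulrDr.
Qed.

Lemma recursionDr n u v1 v2 N :
  recursion n u v1 N -> recursion n u v2 N -> recursion n u (v1 + v2) N.
Proof.
rewrite /recursion => h1 h2.
have bD m : brk u m (v1 + v2) = brk u m v1 + brk u m v2.
  exact: (linD _ _ (brk_linr HV u m)).
rewrite bD (ZsD HV Hs) h1 h2 addrACA -!mulrDr -(twtrD HV Hs); try exact: zmode2_stable.
congr (_ * (_ * _) + _).
  apply: (twtr_ext HV) => w _; rewrite (linD _ _ (zmode_linl HV w)).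
  by rewrite (linD _ _ (zmode_linr HV u)).
rewrite -nsumD; try exact: fsupp_rec.
by apply: eq_nsum => m; rewrite bD qmul_ZsD mulrDr.
Qed.

Lemma recursion_0l n v N : recursion n 0 v N.
Proof.
rewrite /recursion (lin0 (brk_linl HV _ _)) (Zs0 HV Hs).
rewrite (@nsumE _ _ 0) ?big_ord0 => [|m _]; last first.
  by rewrite (lin0 (brk_linl HV _ _)) qmul_Zs0 mulr0.
rewrite addr0 (twtr_ext HV _ (g := fun _ => 0)) ?(twtr0 HV Hs) ?mulr0 // => w _.
exact: (lin0 (zmode_linl HV _)).
Qed.

Lemma recursion_0r n u N : recursion n u 0 N.
Proof.
rewrite /recursion (lin0 (brk_linr HV _ _)) (Zs0 HV Hs).
rewrite (@nsumE _ _ 0) ?big_ord0 => [|m _]; last first.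
  by rewrite (lin0 (brk_linr HV _ _)) qmul_Zs0 mulr0.
rewrite addr0 (twtr_ext HV _ (g := fun _ => 0)) ?(twtr0 HV Hs) ?mulr0 // => w _.
by rewrite (lin0 (zmode_linl HV _)) (lin0 (zmode_linr HV _)).
Qed.

Lemma s_proj_eigen u k : s u = e *: u -> s (proj k u) = e *: proj k u.
Proof. by move=> su; rewrite (s_proj HV Hs) su (linZ _ _ (proj_lin HV k)). Qed.

Lemma recursion1 u v N : s u = e *: u -> recursion 1 u v N.
Proof.
move=> su; apply: (proj_ind HV (Q := fun u => recursion 1 u v N)).
- exact: recursion_0l.
- by move=> x y; apply: recursionDl.
move=> k; have {}su := s_proj_eigen k su; have hu := proj_hom HV k u.
move: (proj k u) hu su => {}u hu su.
apply: (proj_ind HV (Q := fun v => recursion 1 u v N)).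
- exact: recursion_0r.
- by move=> x y; apply: recursionDr.
move=> l; move: (proj l v) (proj_hom HV l v) => {}v hv.
have [n0 hlow] := hom_low HV; have [M0 hM0] := Y_trunc HV u 0 v.
(* One M for both needs: u_i v = 0 beyond it, and weights lowered by more than M from N fall below
   n0. *)
pose M := (M0 + absz (N - n0))%N.
have hM (i : nat) : (M.+1 <= i)%N -> Y u i%:Z v = 0.
  by move=> le; have := hM0 i; rewrite add0r; apply; lia.
have hN : N - M.+1%:Z < n0 by lia.
rewrite /recursion (recursion1_hom hu hv su hlow hM hN) eqxx mul1r; congr (_ + _).
rewrite (@nsumE _ _ M.+1) => [|m le]; last first.
  rewrite (brkE_sum HV (M := 0) hu) ?big_ord0 ?qmul_Zs0 ?mulr0 // => i _.
  by have := hM (m + i)%N; apply; lia.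
apply: eq_bigr => m _; congr (_ * _); symmetry; rewrite add1n; apply: nsumE => i le.
by rewrite (Zs_low HV Hs hlow) ?mulr0 //; lia.
Qed.

(** The absorption identity (m+1) C(n+m, m+1) = n C(n+m, m). *)
Lemma gcoS n m : gco K n m.+1 * - m.+1%:R = n%:R * gco K n.+1 m.
Proof.
rewrite /gco addnS addSn !subn1 /= [in LHS]exprS mulN1r mulNr mulrNN.
by rewrite -mulrA -natrM mulnC mul_bin_left addnK natrM; ring.
Qed.

Lemma s_Lbrk u : s u = e *: u -> s (Lbrk Y om u) = e *: Lbrk Y om u.
Proof.
move=> su; rewrite /Lbrk (linD _ _ (s_lin Hs)) !(s_L Hs) su.
by rewrite /Lop !(linZ _ _ (Y_linr HV om _)) scalerDr.
Qed.

(** Applied to L[-1]u, the left side becomes n times the trace of u[-n-1]v. On the right the m = 0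
    term drops out and the sum shifts by one with n+m unchanged, so the same Eisenstein series
    occur; then the nonzero factor n is cancelled. *)
Lemma recursionS n u v N : (0 < n)%N -> s u = e *: u ->
  recursion n (Lbrk Y om u) v N -> recursion n.+1 u v N.
Proof.
move=> n0 su; rewrite /recursion (brk_Lbrk HV) eqSS (gtn_eqF n0) mul0r add0r.
rewrite (twtr_ext HV _ (g := fun _ => 0)) => [|w _]; last exact: (zmode_Lbrk HV).
rewrite (twtr0 HV Hs) !mulr0 add0r -scaleNr (ZsZ HV Hs) rmorphN /= opprK.
have -> : - n%:Z - 1 = - n.+1%:Z by lia.
have nn : n%:R != 0 :> K by rewrite pnatr_eq0 -lt0n.
move=> h; apply: (mulfI nn); rewrite [LHS]h.
have [D hD] := brk_fsupp HV u v.
rewrite (@nsumE _ _ D.+1) => [|m le]; last first.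
  rewrite (brk_Lbrk HV) (_ : m%:Z - 1 = m.-1%:Z) ?hD ?scaler0 ?oppr0 ?qmul_Zs0 ?mulr0 //; lia.
rewrite (@nsumE _ _ D) => [|m le]; last by rewrite hD // qmul_Zs0 mulr0.
rewrite big_ord_recl (brk_Lbrk HV) mulr0z scale0r oppr0 qmul_Zs0 mulr0 add0r.
rewrite mulr_sumr; apply: eq_bigr => m _; rewrite /= -[bump 0 m]/(m.+1).
rewrite (brk_Lbrk HV) -scaleNr qmul_ZsZ mulrA gcoS addnS addSn -mulrA.
by rewrite (_ : m.+1%:Z - 1 = m%:Z); last by lia.
Qed.

Lemma twisted_recursion n u v N : (0 < n)%N -> s u = e *: u -> recursion n u v N.
Proof.
case: n => // n _; elim: n u => [|n IH] u su; first exact: recursion1.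
by apply: recursionS => //; apply: IH; exact: s_Lbrk.
Qed.

Lemma s_zmode x w : s (zmode x w) = zmode (s x) (s w).
Proof.
rewrite /Defs.zmode (lin_zsum (s_lin Hs) (Y_proj_supp HV x (fun k => k - 1) w)).
by apply: eq_zsum => k; rewrite (s_Y Hs) (s_proj HV Hs).
Qed.

Lemma s_brk u m w : s (brk u m w) = brk (s u) m (s w).
Proof.
rewrite /Defs.brk (lin_zsum (s_lin Hs) (brk_supp HV u m w)); apply: eq_zsum => k.
rewrite /Defs.brk_h (lin_nsum (s_lin Hs) (brk_h_supp HV _ _ _ _)); apply: eq_nsum => i.
by rewrite (linZ _ _ (s_lin Hs)) (s_Y Hs) (s_proj HV Hs).
Qed.

Lemma Zs_brk0 u v N : e = 1 -> s u = e *: u -> Zs (brk u 0 v) N = 0.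
Proof.
move=> e1 su; apply: (proj_ind HV (Q := fun u => Zs (brk u 0 v) N = 0)).
- by rewrite (lin0 (brk_linl HV _ _)) (Zs0 HV Hs).
- by move=> x y hx hy; rewrite (linD _ _ (brk_linl HV 0 v)) (ZsD HV Hs) hx hy addr0.
move=> k; have {}su := s_proj_eigen k su; have hu := proj_hom HV k u.
move: (proj k u) hu su => {}u hu su.
apply: (proj_ind HV (Q := fun v => Zs (brk u 0 v) N = 0)).
- by rewrite (lin0 (brk_linr HV _ _)) (Zs0 HV Hs).
- by move=> x y hx hy; rewrite (linD _ _ (brk_linr HV u 0)) (ZsD HV Hs) hx hy addr0.
move=> l; move: (proj l v) (proj_hom HV l v) => {}v hv.
have [M0 hM0] := Y_trunc HV u 0 v.
have hM (i : nat) : (M0.+1 <= i)%N -> Y u i%:Z v = 0.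
  by move=> le; have := hM0 i; rewrite add0r; apply; lia.
by rewrite (Zs_brk0_hom hu hv su hM) e1 subrr mul0r.
Qed.

End Recursion.

(** * Traces over the fixed points *)

Section FixedPoints.
Variables (R : realType) (V : lmodType R[i]).
Local Notation K := (R[i]).
Variables (Y : V -> int -> V -> V) (vac om : V) (c : K) (proj : int -> V -> V).
Hypothesis HV : is_VOA Y vac om c proj.
Local Notation hom := (homog Y om).
Local Notation zmode := (zmode Y proj).
Variable t : V -> V.
Hypothesis Ht : is_inv_auto Y vac om t.

Lemma inv_auto_id : is_inv_auto Y vac om id.
Proof. by split. Qed.

Lemma Zc_all x N : Zc Y om proj (fun=> True) x N = Zs Y om proj id x N.
Proof.
rewrite /Zc /Zs /twtr; congr (ptrace _ _).
by apply: funext => w; apply: propext; split=> [[]|].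
Qed.

(* The projection (1 + t)/2 onto V^+ turns a trace over V^+ into one over V. *)
Lemma Zc_fixed x N : t x = x -> Zc Y om proj (fun w => t w = w) x N =
  2%:R^-1 * (Zs Y om proj id x N + Zs Y om proj t x N).
Proof.
move=> tx; rewrite /Zc; set P := fun w => _.
have Hid := inv_auto_id.
have tz w : t (zmode x w) = zmode x (t w) by rewrite (s_zmode HV Ht) tx.
have [d [b hb]] := hom_span HV N.
have fP : findim P by apply: (findim_sub (b := b)) => w [/hb].
pose g w := 2%:R^-1 *: (zmode x w + t (zmode x w)).
have two : 2%:R != 0 :> K by rewrite pnatr_eq0.
rewrite (ptrace_ext (g := g) fP) => [|w [_ tw]]; last first.
  by rewrite /g tz tw -mulr2n -[zmode x w *+ 2]scaler_nat scalerA mulVf ?scale1r.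
have fN := hom_findim HV N.
have lz := zmode_linr HV x; have lt := s_lin Ht.
(* [g] agrees with o(x) on V^+_N and maps all of V_N into V^+_N. Cyclicity for the inclusion [id]
   and [g] therefore extends the trace to V_N. *)
rewrite (@ptrace_cyclic _ _ P (hom N) id g) //.
- have st1 : stable (hom N) (zmode x) := zmode_hom HV x (n := N).
  have st2 : stable (hom N) (fun w => t (zmode x w)).
    by move=> w hw; apply: (s_hom Ht); apply: st1.
  have st3 : stable (hom N) (fun w => 1 *: zmode x w + t (zmode x w)).
    by move=> w hw; apply: (hom_subsp HV N).2; [apply: st1|apply: st2].
  have st0 : stable (hom N) (fun=> 0) by move=> w _; exact: (hom0 HV).
  have := ptrace_lin 1 fN st1 st2; rewrite mul1r => e1.
  have := ptrace_lin 2%:R^-1 fN st3 st0; rewrite (ptrace0 fN) addr0 e1 => <-.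
  by apply: ptrace_ext => // w _; rewrite /g scale1r addr0.
- move=> k w w'; rewrite /g lz lt addrACA.
  by rewrite -[k *: _ + k *: _]scalerDr [LHS]scalerDr !scalerA mulrC.
- by move=> w [].
- move=> w hw; have hz := zmode_hom HV x hw; split.
    by apply/(homZ HV)/(homD HV) => //; exact: (s_hom Ht).
  rewrite /g (linZ _ _ lt) (linD _ _ lt) addrC; congr (_ *: (_ + _)).
  by case: Ht => _ _ _ _ ->.
Qed.

End FixedPoints.

Theorem theorem6p1 (R : realType) (V : lmodType R[i])
  (Y : V -> int -> V -> V) (vac om : V) (c : R[i]) (proj : int -> V -> V)
  (HV : is_VOA Y vac om c proj)
  (t : V -> V) (Ht : is_inv_auto Y vac om t)
  (u v : V) (hu : t u = - u) (hv : t v = - v) (n : nat) (hn : (1 <= n)%N) :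
  let Vplus := fun w : V => t w = w in
  let Vall := fun _ : V => True in
  forall N : int,
    Zc Y om proj Vplus (brk Y proj u (- n%:Z) v) N =
      (n == 1%N)%:R / 2%:R *
        ptrace (homog Y om N) (fun w => zmode Y proj u (zmode Y proj v w))
    + nsum (fun m : nat =>
        gco _ n m * qmul (Fc _ (n + m)) (Zc Y om proj Vplus (brk Y proj u m%:Z v)) N)
    + 2%:R^-1 * nsum (fun m : nat =>
        if m == 0%N then 0 else
        gco _ n m * qmul (fun i => Ec _ (n + m) i - Fc _ (n + m) i)
                         (Zc Y om proj Vall (brk Y proj u m%:Z v)) N).
Proof.
move=> Vplus Vall N.
have Hid := inv_auto_id Y vac om.
pose z1 := Zs Y om proj id; pose zt := Zs Y om proj t; pose B m := brk Y proj u m v.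
have tB m : t (B m) = B m.
  rewrite (s_brk HV Ht) hu hv (linN _ (brk_linl HV m _)) (linN _ (brk_linr HV u m)).
  exact: opprK.
have zp m N' : Zc Y om proj Vplus (B m) N' = 2%:R^-1 * (z1 (B m) N' + zt (B m) N').
  exact: (Zc_fixed HV Ht).
have za x N' : Zc Y om proj Vall x N' = z1 x N' by exact: Zc_all.
have su1 : id u = 1 *: u by rewrite scale1r.
have sut : t u = -1 *: u by rewrite scaleN1r.
have r1 := twisted_recursion HV Hid (mulr1 1) v N hn su1.
have ee : -1 * -1 = 1 :> R[i] by rewrite mulrNN mulr1.
have rt := twisted_recursion HV Ht ee v N hn sut.
have [M hM] := brk_fsupp HV u v; have [n0 hlow] := hom_low HV.
pose D := (absz (N - n0)).+1.
have z1low x (i : nat) : (D <= i)%N -> z1 x (N - i%:Z) = 0.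
  by move=> le; apply: (Zs_low HV Hid hlow); lia.
have ztlow x (i : nat) : (D <= i)%N -> zt x (N - i%:Z) = 0.
  by move=> le; apply: (Zs_low HV Ht hlow); lia.
have q1 f x : qmul f (z1 x) N = \sum_(i < D) f i * z1 x (N - i%:Z).
  by apply: nsumE => i le; rewrite z1low ?mulr0.
have qt f x : qmul f (zt x) N = \sum_(i < D) f i * zt x (N - i%:Z).
  by apply: nsumE => i le; rewrite ztlow ?mulr0.
have qp f m : qmul f (Zc Y om proj Vplus (B m)) N =
    2%:R^-1 * (qmul f (z1 (B m)) N + qmul f (zt (B m)) N).
  rewrite q1 qt -big_split mulr_sumr /=.
  rewrite /qmul (@nsumE _ _ D) => [|i le]; last by rewrite zp z1low ?ztlow ?addr0 ?mulr0.
  by apply: eq_bigr => i _; rewrite zp; ring.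
have qa f m : qmul f (Zc Y om proj Vall (B m)) N = qmul f (z1 (B m)) N.
  by apply: eq_nsum => i; rewrite za.
(* The untwisted case s = id has e = 1 whatever the sign of t on u; this vanishing accounts for the
   missing m = 0 term of the sum over V. *)
have z10 N' : z1 (B 0) N' = 0 by apply: (Zs_brk0 HV Hid (mulr1 1)) => //.
have q10 f : qmul f (z1 (B 0)) N = 0.
  by rewrite q1 big1 // => i _; rewrite z10 mulr0.
have B0 m f s : (M <= m)%N -> is_inv_auto Y vac om s -> qmul f (Zs Y om proj s (B m%:Z)) N = 0.
  by move=> le Hs; rewrite /B hM // (qmul_Zs0 HV Hs).
have {}r1 : z1 (B (- n%:Z)) N = (n == 1%N)%:R * ((1 + 1) / 2%:R *
    ptrace (homog Y om N) (fun w => zmode Y proj u (zmode Y proj v w)))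
  + \sum_(m < M) gco R[i] n m * qmul (Ec R[i] (n + m)) (z1 (B m%:Z)) N.
  rewrite /z1 r1; congr (_ + _); rewrite (@nsumE _ _ M) => [|m le].
    by apply: eq_bigr => m _; rewrite Gc1.
  by rewrite B0 ?mulr0.
have {}rt : zt (B (- n%:Z)) N =
    \sum_(m < M) gco R[i] n m * qmul (Fc R[i] (n + m)) (zt (B m%:Z)) N.
  rewrite /zt rt subrr !mul0r mulr0 add0r (@nsumE _ _ M) => [|m le].
    by apply: eq_bigr => m _; rewrite GcN1.
  by rewrite B0 ?mulr0.
rewrite zp r1 rt (@nsumE _ _ M) => [|m le]; last first.
  by rewrite qp !B0 // addr0 !mulr0.
rewrite (@nsumE _ _ M) => [|m le]; last by rewrite qa B0 // mulr0 if_same.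
rewrite -addrA mulrDr -addrA; congr (_ + _); first by field.
rewrite -big_split !mulr_sumr -big_split; apply: eq_bigr => m _ /=.
(* Termwise, with z1 and zt the traces for [id] and [t]: (E z1 + F zt)/2 = F (z1 + zt)/2 + (E - F)
   z1/2; at m = 0 the z1 parts vanish. *)
rewrite qp qa; case: eqP => [->|_].
  by rewrite !q10; ring.
have -> : qmul (fun i => Ec R[i] (n + m) i - Fc R[i] (n + m) i) (z1 (B m%:Z)) N =
    qmul (Ec R[i] (n + m)) (z1 (B m%:Z)) N - qmul (Fc R[i] (n + m)) (z1 (B m%:Z)) N.
  by rewrite !q1 -sumrB; apply: eq_bigr => i _; rewrite mulrBl.
by field.
Qed.
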